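(* Let $n\geq 2$ and $1\leq d\leq n-1$. The dimension of the Dressian $\operatorname{Dr}(d,n)$ satisfies $$\frac{1}{n}\binom{n}{d}-1\ \leq\ \dim \operatorname{Dr}(d,n)\ \leq\ \binom{n-2}{d-1}-1 .$$
   Context: The hypersimplex $\Delta(d,n)=[0,1]^n\cap\{\sum_i x_i=d\}$ is the convex hull of the characteristic vectors of all $d$-element subsets of $[n]$. The matroid polytope of a matroid is the convex hull of the characteristic vectors of its bases. A lifting function on the vertices of a polytope $P$ induces a regular subdivision of $P$ (by projecting the lower faces of the lifted polytope); the lifting functions inducing the same subdivision form a relatively open polyhedral cone, and these cones form the secondary fan of $P$. A tropical Plücker vector is a lifting function $\pi\in\mathbb{R}^{\binom{n}{d}}$ on the vertices of $\Delta(d,n)$ such that every cell of the induced regular subdivision is a matroid polytope. The Dressian $\operatorname{Dr}(d,n)$ is the subfan of the secondary fan of $\Delta(d,n)$ formed by the tropical Plücker vectors. Dimensions are always taken modulo the lineality space of the secondary fan (which is the $n$-dimensional space of restrictions of affine functions to the vertices of $\Delta(d,n)$). *)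

(* Defs.v *)
From mathcomp Require Import all_boot all_order all_algebra.
From mathcomp Require Import boolp classical_sets reals.

Set Implicit Arguments.
Unset Strict Implicit.
Unset Printing Implicit Defensive.

Import GRing.Theory.
Local Open Scope classical_set_scope.
Local Open Scope ring_scope.

Section Span.
Variables (K : fieldType) (V : vectType K).
Implicit Types (X : set V) (U W : {vspace V}).

Definition sub_vspace X U : Prop := forall v, X v -> v \in U.

(* The default value 0%VS is never used: see lin_spanP. *)
Definition lin_span X : {vspace V} :=
  xget 0%VS [set U | sub_vspace X U /\
                     (forall W, sub_vspace X W -> (U <= W)%VS)].

Lemma lin_spanP X : sub_vspace X (lin_span X) /\
  (forall W, sub_vspace X W -> (lin_span X <= W)%VS).
Proof.
suff : exists U, sub_vspace X U /\ (forall W, sub_vspace X W -> (U <= W)%VS).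
  exact: xgetPex.
have ex : exists k, `[< exists2 U, sub_vspace X U & \dim U = k >].
  by exists (\dim {:V}); apply/asboolP; exists fullv => // v _; exact: memvf.
case: (ex_minnP ex) => m /asboolP[U XU dU] mmin.
exists U; split=> // W XW.
have XUW : sub_vspace X (U :&: W)%VS.
  by move=> v Xv; rewrite memv_cap XU ?XW.
have := mmin (\dim (U :&: W)%VS).
move=> /(_ (asboolT (ex_intro2 _ _ _ XUW erefl))) le_m.
have /eqP <- : (U :&: W == U)%VS by rewrite eqEdim capvSl dU.
exact: capvSr.
Qed.

(* The dimension of (the linear hull of) C in the quotient space V / L. *)
Definition cone_dim_mod (L : {vspace V}) (C : set V) : nat :=
  (\dim (lin_span C + L) - \dim L)%N.

(* A fan is given by the set of its cones; its dimension is the largest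
   dimension of a cone.  The range of k is no restriction: see leq_fan_dim. *)
Definition fan_dim_mod (L : {vspace V}) (F : set (set V)) : nat :=
  \max_(k < (\dim {:V}).+1 | `[< exists2 C, F C & cone_dim_mod L C = k >]) k.

Lemma leq_fan_dim (L : {vspace V}) (F : set (set V)) (C : set V) :
  F C -> (cone_dim_mod L C <= fan_dim_mod L F)%N.
Proof.
move=> FC; have lt : (cone_dim_mod L C < (\dim {:V}).+1)%N.
  by rewrite ltnS (leq_trans (leq_subr _ _)) // dimvS // subvf.
rewrite /fan_dim_mod; apply: (@leq_bigmax_cond _ _ _ (Ordinal lt)).
by apply/asboolP; exists C.
Qed.

Lemma fan_dim_attained (L : {vspace V}) (F : set (set V)) :
  F !=set0 -> exists2 C, F C & cone_dim_mod L C = fan_dim_mod L F.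
Proof.
move=> [C0 FC0]; have lt : (cone_dim_mod L C0 < (\dim {:V}).+1)%N.
  by rewrite ltnS (leq_trans (leq_subr _ _)) // dimvS // subvf.
rewrite /fan_dim_mod.
have P0 : `[< exists2 C, F C & cone_dim_mod L C = Ordinal lt >].
  by apply/asboolP; exists C0.
rewrite (bigmax_eq_arg (Ordinal lt)) //.
by case: arg_maxnP => // k /asboolP.
Qed.

End Span.

Section Subdivisions.
Variable R : realType.

Definition conv_hull (m : nat) (I : finType) (A : {set I}) (a : I -> 'rV[R]_m) :
    set 'rV[R]_m :=
  [set x | exists l : I -> R,
     [/\ forall i, i \in A -> 0 <= l i, \sum_(i in A) l i = 1
       & x = \sum_(i in A) l i *: a i]].

Definition dot (m : nat) (u v : 'rV[R]_m) : R := \sum_i u 0 i * v 0 i.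

(* In this section the points a i are meant to be the vertices of a polytope,
   listed without repetition by the finite type I. *)
Variables (n : nat) (I : finType) (a : I -> 'rV[R]_n).

(* R^o is R seen as a vector space over itself. *)
Notation lifting := {ffun I -> R^o}.

Definition lifted_polytope (w : lifting) : set 'rV[R]_(n + 1) :=
  conv_hull [set: I]%SET (fun i => row_mx (a i) (w i)%:M).

(* A lower face is a face minimizing a linear functional whose last
   coordinate is positive. *)
Definition lower_face (w : lifting) (F : set 'rV[R]_(n + 1)) : Prop :=
  exists2 c : 'rV[R]_(n + 1), 0 < c 0 (rshift n ord0) &
    F = [set p | lifted_polytope w p /\
                 (forall q, lifted_polytope w q -> dot c p <= dot c q)].

(* The set of all (nonempty) cells, of every dimension. *)
Definition regular_subdivision (w : lifting) : set (set 'rV[R]_n) :=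
  [set lsubmx @` F | F in lower_face w].

Definition secondary_cone (w : lifting) : set lifting :=
  [set w' | regular_subdivision w' = regular_subdivision w].

Definition secondary_fan : set (set lifting) := range secondary_cone.

Definition affine_restriction (w : lifting) : Prop :=
  exists (c : 'rV[R]_n) (b : R), forall i, w i = dot c (a i) + b.

(* The affine restrictions already form a subspace: see mem_lineality. *)
Definition lineality : {vspace lifting} := lin_span affine_restriction.

Lemma mem_lineality w : w \in lineality <-> affine_restriction w.
Proof.
split; last by case: (lin_spanP affine_restriction) => + _; apply.
case: (lin_spanP affine_restriction) => _ least.
pose f (k : 'I_n + unit) : lifting :=
  [ffun i => if k is inl j then a i 0 j else 1].
have comb (g : 'I_n + unit -> R) :
    affine_restriction (\sum_k g k *: f k).
  exists (\row_j g (inl j)), (g (inr tt)) => i.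
  rewrite sum_ffunE big_sumType /= [X in _ + X = _](big_pred1 tt); last by case.
  rewrite !ffunE [_ *: 1]mulr1.
  by congr (_ + _); apply: eq_bigr => j _; rewrite !ffunE mxE.
have sub : sub_vspace affine_restriction (\sum_k <[f k]>)%VS.
  move=> v [c [b vE]].
  have -> : v = \sum_k (if k is inl j then c 0 j else b) *: f k.
    apply/ffunP => i; rewrite vE sum_ffunE big_sumType /=.
    rewrite [X in _ = _ + X](big_pred1 tt); last by case.
    rewrite !ffunE [_ *: 1]mulr1.
    by congr (_ + _); apply: eq_bigr => j _; rewrite !ffunE.
  by apply: memv_suml => k _; rewrite (subvP (sumv_sup k _ (subvv _))) // memvZ ?memv_line.
move=> /(subvP (least _ sub))/memv_sumP[u uf ->].
have /choice[g gE] : forall k, exists x, u k = x *: f k.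
  by move=> k; apply/vlineP; exact: uf.
by rewrite (eq_bigr (fun k => g k *: f k)) // => k _.
Qed.

End Subdivisions.

Section Dressian.
Variables (R : realType) (d n : nat).

Definition char_vec (S : {set 'I_n}) : 'rV[R]_n := \row_i (i \in S)%:R.

Definition is_matroid_bases (BB : {set {set 'I_n}}) : Prop :=
  BB != finset.set0 /\
  (forall B1 B2 x, B1 \in BB -> B2 \in BB -> x \in B1 :\: B2 ->
     exists2 y, y \in B2 :\: B1 & y |: (B1 :\ x) \in BB).

Definition is_matroid_polytope (P : set 'rV[R]_n) : Prop :=
  exists2 BB : {set {set 'I_n}}, is_matroid_bases BB & P = conv_hull BB char_vec.

(* The d-subsets of [n] index the vertices of the hypersimplex Delta(d,n). *)
Definition dsubset : finType := {S : {set 'I_n} | #|S| == d}.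

Definition hypersimplex_vertex (S : dsubset) : 'rV[R]_n := char_vec (val S).

Definition tropical_plucker (w : {ffun dsubset -> R^o}) : Prop :=
  forall P, regular_subdivision hypersimplex_vertex w P -> is_matroid_polytope P.

(* The cones of the secondary fan of Delta(d,n) that consist of tropical
   Plücker vectors; this property depends only on the induced subdivision. *)
Definition Dressian : set (set {ffun dsubset -> R^o}) :=
  [set C | secondary_fan hypersimplex_vertex C /\ C `<=` tropical_plucker].

(* Dimension modulo the lineality space of the secondary fan. *)
Definition dim_Dressian : nat :=
  fan_dim_mod (lineality hypersimplex_vertex) Dressian.

End Dressian.

(* Main.v *)
(** Lower bound.  The d-subsets X of {0, .., n-1} with a prescribed value of
    the sum of X modulo n form a stable set S of the Johnson graph, and some
    residue gives |S| >= 'C(n, d) / n.  Every nonnegative lifting supported on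
    S is a tropical Plücker vector.  There are finitely many subdivisions, so
    one secondary cone contains |S| points of a moment curve in the positive
    orthant of R^S, hence spans R^S; and R^S meets the lineality space in
    dimension at most 1, because an affine function that vanishes off S is
    determined by its value at any one element of S.

    Upper bound.  Every u in the span of the cone is affine on each cell, and
    this passes to the faces of the hypersimplex (the minors).  Splitting at an
    element e bounds the dimension for a minor on m elements by the sum of the
    dimensions for the deletion and the contraction of e, minus m - 3, so
    Pascal's rule gives 'C(m - 2, r - 1) + m - 1 in rank r.  The m - 3 gained
    conditions come from a cell M such that the linear functionals constant on
    the deletion of M, or on its contraction, all belong to one common space
    spanned by the indicators of a set F and of its complement.  Such an M is
    reached from a cell with connected contraction by repeatedly crossing the
    wall cut out by a component of the deletion. *)
From HB Require Import structures.
Require Import Defs.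
From mathcomp Require Import all_boot all_order all_algebra.
From mathcomp Require Import reals zify lra boolp.
From mathcomp Require classical_sets.

Set Implicit Arguments.
Unset Strict Implicit.
Unset Printing Implicit Defensive.

Import Order.TTheory GRing.Theory Num.Theory.
Local Open Scope ring_scope.

(** * Basis exchange *)

Section Exchange.
Variable T : finType.
Implicit Types (A M : {set {set T}}) (X Y S : {set T}) (x y z e : T).

Definition swap X x y := y |: (X :\ x).

Definition exchange M := forall X Y x, X \in M -> Y \in M -> x \in X :\: Y ->
  exists2 y, y \in Y :\: X & swap X x y \in M.

Definition equicard M := exists d, forall X, X \in M -> #|X| = d.

Lemma card_swap X x y : x \in X -> y \notin X -> #|swap X x y| = #|X|.
Proof.
move=> xX yX; rewrite cardsU1 !inE (negPf yX) andbF /= add1n.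
by rewrite (cardsD1 x X) xX.
Qed.

Lemma swapK X x y : x \in X -> y \notin X -> swap (swap X x y) y x = X.
Proof.
move=> xX yX; apply/setP => z; rewrite !inE.
case: (eqVneq z x) => [->|zx] /=; first by rewrite xX.
by case: (eqVneq z y) => [->|//]; rewrite (negPf yX).
Qed.

(** The balance avoids subtraction, so that it serves cardinalities in [nat] as well as values in a
    field. *)
Lemma big_swap (V : nmodType) (g : T -> V) X x y : x \in X -> y \notin X ->
  \sum_(z in swap X x y) g z + g x = \sum_(z in X) g z + g y.
Proof.
move=> xX yX; rewrite big_setU1 ?inE ?(negPf yX) ?andbF //= (big_setD1 x xX) /=.
by rewrite [LHS]addrC [g y + _]addrC addrA.
Qed.

Lemma card_setI_sum X S : #|X :&: S| = (\sum_(z in X) (z \in S : nat))%N.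
Proof.
rewrite -sum1_card big_mkcond [RHS]big_mkcond; apply: eq_bigr => z _.
by rewrite inE; case: (z \in X); case: (z \in S).
Qed.

Lemma card_swapI X x y S : x \in X -> y \notin X ->
  (#|swap X x y :&: S| + (x \in S) = #|X :&: S| + (y \in S))%N.
Proof. by move=> xX yX; rewrite !card_setI_sum; exact: (@big_swap nat). Qed.

Lemma card_setD_eq X Y : #|X| = #|Y| -> X :\: Y = set0 -> X = Y.
Proof.
move=> cXY /eqP; rewrite setD_eq0 => XY; apply/eqP.
by rewrite eqEcard XY cXY leqnn.
Qed.

Lemma card_swapD X Y x y : x \in X :\: Y -> y \in Y :\: X ->
  (#|swap X x y :\: Y| < #|X :\: Y|)%N.
Proof.
move=> xXY; rewrite inE => /andP[yX yY].
rewrite [in X in (_ < X)%N](cardsD1 x) xXY add1n ltnS; apply: subset_leq_card.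
apply/subsetP => z; rewrite !inE => /andP[zY]; rewrite zY.
by case: (eqVneq z y) => [zy|_ //]; move: zY; rewrite zy yY.
Qed.

(** For the bases of a matroid, the classes of the connectivity that this relation generates are the
    connected components. *)
Definition adjacent A x y :=
  [exists X in A, [&& x \in X, y \notin X & swap X x y \in A]].

Lemma adjacentP A x y : reflect
  (exists X, [/\ X \in A, x \in X, y \notin X & swap X x y \in A]) (adjacent A x y).
Proof.
apply: (iffP exists_inP) => [[X XA /and3P[]]|[X []]]; first by exists X; split.
by move=> *; exists X => //; apply/and3P; split.
Qed.

Lemma adjacent_sym A : symmetric (adjacent A).
Proof.
suff H x y : adjacent A x y -> adjacent A y x by move=> x y; apply/idP/idP; exact: H.
move=> /adjacentP[X [XA xX yX XA']]; apply/adjacentP; exists (swap X x y); split=> //.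
- by rewrite !inE eqxx.
- by apply: contraNN yX; rewrite !inE eqxx /= orbF => /eqP <-.
- by rewrite swapK.
Qed.

Definition const_on (V : nmodType) A (g : T -> V) :=
  forall X Y, X \in A -> Y \in A -> \sum_(z in X) g z = \sum_(z in Y) g z.

Lemma const_on_adjacent (V : zmodType) A (g : T -> V) x y :
  const_on A g -> adjacent A x y -> g x = g y.
Proof.
move=> gA /adjacentP[X [XA xX yX XA']].
have := big_swap g xX yX; rewrite (gA _ _ XA' XA) => /addrI; exact.
Qed.

(** Exchanges lead from [X] to [Y] one element at a time, and no step changes the sum. Cancellation
    is a hypothesis because the values may lie in [nat]. *)
Lemma adjacent_const_on (V : nmodType) A (g : T -> V) : exchange A -> equicard A ->
  (forall x y, adjacent A x y -> g x = g y) ->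
  (forall u v a : V, u + a = v + a -> u = v) -> const_on A g.
Proof.
move=> exA [d cA] gA canc X Y XA YA; have [k] := ubnP #|X :\: Y|.
elim: k X XA => // k IH X XA ltk.
have [XY|[x xXY]] := set_0Vmem (X :\: Y).
  by rewrite (card_setD_eq _ XY) // !cA.
have [y yYX XA'] := exA _ _ _ XA YA xXY.
have lt' := leq_trans (card_swapD xXY yYX) ltk.
rewrite -(IH _ XA' lt').
move: xXY yYX; rewrite !inE => /andP[_ xX] /andP[yX _].
apply: (canc _ _ (g y)); rewrite -(big_swap g xX yX).
by congr (_ + _); apply: gA; apply/adjacentP; exists X.
Qed.

Lemma const_on_connect (V : zmodType) A (g : T -> V) x y :
  const_on A g -> connect (adjacent A) x y -> g x = g y.
Proof.
move=> gA xy; apply/eqP.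
have cl : closed (adjacent A) [pred z | g x == g z].
  by move=> z t /(const_on_adjacent gA) gzt; rewrite !inE gzt.
by have := closed_connect cl xy; rewrite !inE eqxx => <-.
Qed.

(** For the bases of a matroid, such an [S] is a separator, that is, a union of connected
    components. *)
Definition const_card A S := forall X Y, X \in A -> Y \in A -> #|X :&: S| = #|Y :&: S|.

Lemma const_card_adjacent A S x y :
  const_card A S -> adjacent A x y -> (x \in S) = (y \in S).
Proof.
move=> SA /adjacentP[X [XA xX yX XA']].
have := card_swapI S xX yX; rewrite (SA _ _ XA' XA).
by case: (x \in S); case: (y \in S) => //; lia.
Qed.

Lemma adjacent_const_card A S : exchange A -> equicard A ->
  (forall x y, adjacent A x y -> (x \in S) = (y \in S)) -> const_card A S.
Proof.
move=> exA cA SA X Y XA YA; rewrite !card_setI_sum.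
apply: (@adjacent_const_on nat A (fun z => (z \in S : nat))) => //.
  by move=> x y /SA ->.
by move=> u v a /addIn.
Qed.

(** Here the entering element is prescribed instead of the leaving one. Exchanging an element of
    [Y :\: X] other than [y] brings [Y] closer to [X] and keeps [y]; once [y] is alone in [Y :\: X],
    one swap turns [X] into [Y]. *)
Lemma exchange_out M X Y y : exchange M -> equicard M -> X \in M -> Y \in M ->
  y \in Y :\: X -> exists2 x, x \in X :\: Y & swap X x y \in M.
Proof.
move=> exM [d cM] XM YM; have [k] := ubnP #|Y :\: X|.
elim: k Y YM => // k IH Y YM ltk yYX.
have [|[z zD]] := set_0Vmem ((Y :\: X) :\ y).
  move=> D0; have YX1 : Y :\: X = [set y].
    by rewrite -(setD1K yYX) D0 setU0.
  have /eqP : #|X :\: Y| = 1%N.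
    have := cardsID Y X; have := cardsID X Y.
    by rewrite YX1 cards1 [Y :&: X]setIC (cM _ XM) (cM _ YM); lia.
  move=> /cards1P[x XYx]; exists x; first by rewrite XYx inE.
  suff -> : swap X x y = Y by [].
  have xXY : x \in X :\: Y by rewrite XYx inE.
  apply: card_setD_eq.
    move: xXY yYX; rewrite !inE => /andP[_ xX] /andP[yX _].
    by rewrite card_swap // !cM.
  have := card_swapD xXY yYX; rewrite XYx cards1 ltnS leqn0.
  by rewrite cards_eq0 => /eqP.
move: zD; rewrite in_setD1 => /andP[zy zYX].
have [x' xXY' YM'] := exM _ _ _ YM XM zYX.
have lt' := leq_trans (card_swapD zYX xXY') ltk.
have [|x xD xM] := IH _ YM' lt'.
  move: yYX; rewrite !in_setD => /andP[-> yY]; rewrite in_setU1 in_setD1 yY.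
  by rewrite [y == z]eq_sym zy orbT.
exists x => //; move: xD; rewrite !inE negb_or negb_and negbK.
move=> /andP[/andP[_ /orP[/eqP ->|->]] xX] //.
by move: zYX; rewrite inE xX.
Qed.

(** A separator splits a matroid into a direct sum, so the parts of two bases combine freely. The
    part of [Y] in [S] is exchanged towards [Y0]; each entering element lies in [S] again, so
    nothing changes outside [S]. *)
Lemma exchange_mix A S Y Y0 : exchange A -> equicard A -> const_card A S ->
  Y \in A -> Y0 \in A -> (Y :\: S) :|: (Y0 :&: S) \in A.
Proof.
move=> exA cA SA + Y0A; have [k] := ubnP #|(Y :&: S) :\: Y0|.
elim: k Y => // k IH Y ltk YA.
have [D0|[x]] := set_0Vmem ((Y :&: S) :\: Y0).
  have YS : Y :&: S = Y0 :&: S.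
    apply/eqP; rewrite eqEcard (SA _ _ YA Y0A) leqnn andbT.
    by rewrite subsetI subsetIr andbT -setD_eq0 D0.
  by rewrite -YS setUC setID.
rewrite !inE => /and3P[xY0 xY xS].
have [|y] := exA _ _ x YA Y0A; first by rewrite inE xY0.
rewrite inE => /andP[yY yY0] YA'.
have yS : y \in S.
  by rewrite -(@const_card_adjacent A S x y) //; apply/adjacentP; exists Y.
have -> : Y :\: S = swap Y x y :\: S.
  apply/setP => z; rewrite !inE.
  case: (eqVneq z y) => [->|_]; first by rewrite yS.
  by case: (eqVneq z x) => [->|//]; rewrite xS.
apply: IH => //; rewrite ltnS in ltk; apply: leq_trans ltk.
rewrite [in X in (_ < X)%N](cardsD1 x) !inE xY0 xY xS add1n ltnS.
apply: subset_leq_card; apply/subsetP => z; rewrite !inE => /andP[zY0].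
rewrite zY0 => /andP[+ zS]; rewrite zS andbT /=.
by case: (eqVneq z y) => [zy|_ //]; move: zY0; rewrite zy yY0.
Qed.

Definition del M e := [set X in M | e \notin X].
(** The members keep [e], so that deletion and contraction are both subfamilies of [M], on opposite
    sides of a split of the polytope. *)
Definition con M e := [set X in M | e \in X].

Lemma exchange_del M e : exchange M -> exchange (del M e).
Proof.
move=> exM X Y x; rewrite !inE => /andP[XM eX] /andP[YM eY] xXY.
have [|y yYX XM'] := exM _ _ x XM YM; first by rewrite inE.
exists y; rewrite // !inE XM' (negPf eX) andbF orbF /=.
by apply: contraNneq eY => ->; move: yYX; rewrite inE => /andP[].
Qed.

Lemma exchange_con M e : exchange M -> exchange (con M e).
Proof.
move=> exM X Y x; rewrite !inE => /andP[XM eX] /andP[YM eY] xXY.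
have [|y yYX XM'] := exM _ _ x XM YM; first by rewrite inE.
exists y; rewrite // !inE XM' eX andbT; apply/orP; right.
by apply: contraNneq (proj1 (andP xXY)) => <-.
Qed.

Lemma equicard_sub M A : A \subset M -> equicard M -> equicard A.
Proof. by move=> /subsetP AM [d cM]; exists d => X /AM /cM. Qed.

Lemma del_sub M e : del M e \subset M.
Proof. by apply/subsetP => X; rewrite inE => /andP[]. Qed.

Lemma con_sub M e : con M e \subset M.
Proof. by apply/subsetP => X; rewrite inE => /andP[]. Qed.

(** * Passing exchanges between deletion and contraction *)

Section Transfer.
Variables (M : {set {set T}}) (e : T).
Hypotheses (exM : exchange M) (cM : equicard M).
Let A := del M e.
Let B := con M e.
Let exA : exchange A := exchange_del exM.
Let exB : exchange B := exchange_con exM.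
Let cA : equicard A := equicard_sub (del_sub M e) cM.
Let cB : equicard B := equicard_sub (con_sub M e) cM.

Lemma con_to_del X Y : X \in B -> Y \in A ->
  exists2 u, u \in Y :\: X & swap X e u \in A.
Proof.
rewrite !inE => /andP[XM eX] /andP[YM eY].
have [|u uYX XM'] := exM XM YM (x := e); first by rewrite inE eY.
exists u => //; rewrite !inE XM' eqxx orbF; move: uYX; rewrite inE => /andP[uX _].
by apply: contraNneq uX => <-.
Qed.

Lemma del_to_con X Y : X \in A -> Y \in B ->
  exists2 z, z \in X :\: Y & swap X z e \in B.
Proof.
rewrite !inE => /andP[XM eX] /andP[YM eY].
have [|z zXY XM'] := exchange_out exM cM XM YM (y := e); first by rewrite inE eX.
by exists z => //; rewrite !inE XM' eqxx.
Qed.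

(** The set [X0] shows that [S] loses rank when [e] is contracted. So [e] can take the place of an
    element of [S], and the part of a basis outside [S] is free to be exchanged as in the
    deletion. *)
Lemma adjacent_del_con S X0 Y0 x y : const_card A S -> e \notin S ->
  X0 \in B -> Y0 \in A -> (#|X0 :&: S| < #|Y0 :&: S|)%N ->
  x \notin S -> y \notin S -> adjacent A x y ->
  exists Z, [/\ Z \in B, x \in Z, y \notin Z, swap Z x y \in B &
    (#|Z :&: S| < #|Y0 :&: S|)%N].
Proof.
move=> SA eS X0B Y0A lt0 xS yS /adjacentP[Y [YA xY yY YA']].
have [z] := con_to_del X0B Y0A.
rewrite inE => /andP[zX0 zY0] XA.
have eX0 : e \in X0 by move: X0B; rewrite inE => /andP[].
have zS : z \in S.
  have := card_swapI S eX0 zX0; rewrite (SA _ _ XA Y0A) (negPf eS) addn0.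
  by case: (z \in S) => // h; rewrite h addn0 ltnn in lt0.
(* [swap X0 e z] belongs to [A], so its part in [S] completes the part outside [S] of any member of
   [A]. *)
pose mix Z := (Z :\: S) :|: (swap X0 e z :&: S).
have mixP Z : Z \in A -> swap (mix Z) z e \in B /\ z \in mix Z.
  move=> ZA; have mA : mix Z \in A by apply: exchange_mix.
  have zm : z \in mix Z by rewrite !inE zS eqxx /= ?orbT.
  split=> //.
  have mM : mix Z \in M by apply: (subsetP (del_sub M e)).
  have X0M : X0 \in M by apply: (subsetP (con_sub M e)).
  (* Removing [z] towards [X0] must bring in [e]: any other [u] would give a member of [A], hence
     lie in [S], but [mix Z] already contains [X0 :&: S]. *)
  have [|u] := exM mM X0M (x := z); first by rewrite in_setD zX0.
  rewrite in_setD => /andP[um uX0] ZM.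
  have [ue|ue] := eqVneq u e; first by rewrite -ue !inE ZM ue eqxx.
  have em : e \notin mix Z by move: mA; rewrite inE => /andP[].
  have ZA' : swap (mix Z) z u \in A.
    by rewrite inE ZM in_setU1 in_setD1 (negPf em) andbF orbF eq_sym.
  have uS : u \in S.
    have := card_swapI S zm um; rewrite (SA _ _ ZA' mA) zS.
    by case: (u \in S) => // /addnI.
  by move: um; rewrite !inE uS uX0 ue /= ?orbT.
have [ZB zm] := mixP _ YA; have [ZB' zm'] := mixP _ YA'.
have xz : x != z by apply: contraNneq xS => ->.
have yz : y != z by apply: contraNneq yS => ->.
have eY : e \notin Y by move: YA; rewrite inE => /andP[].
have eY' : e \notin swap Y x y by move: YA'; rewrite inE => /andP[].
have ye : y != e by apply: contraNneq eY' => <-; rewrite !inE eqxx.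
exists (swap (mix Y) z e); split => //.
- by rewrite !inE xz xS xY /= ?orbT.
- by rewrite !inE (negPf ye) (negPf yS) (negPf yY) !andbF.
- suff -> : swap (swap (mix Y) z e) x y = swap (mix (swap Y x y)) z e by [].
  apply/setP => t; rewrite !inE.
  case: (eqVneq t y) => [->|ty] /=.
    by rewrite (negPf ye) yS yz.
  case: (eqVneq t x) => [->|tx] //=.
  rewrite (negPf xS) !andbF /= orbF; apply/esym/negbTE.
  by apply: contraNneq eY => <-.
- have em : e \notin mix Y.
    by have := exchange_mix exA cA SA YA XA; rewrite inE => /andP[].
  have := card_swapI S zm em; rewrite zS (negPf eS).
  by rewrite (SA (mix Y) Y0) ?exchange_mix // addn0 addn1 => <-.
Qed.

(** Dual to [adjacent_del_con]: an element of [S] takes the place of [e]. *)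
Lemma adjacent_con_del S X0 Y0 x y : const_card B S -> e \notin S ->
  X0 \in A -> Y0 \in B -> (#|Y0 :&: S| < #|X0 :&: S|)%N ->
  x \notin S -> y \notin S -> adjacent B x y -> adjacent A x y.
Proof.
move=> SB eS X0A Y0B lt0 xS yS /adjacentP[Y [YB xY yY YB']].
have [z] := del_to_con X0A Y0B.
rewrite inE => /andP[zY0 zX0] XB.
have eX0 : e \notin X0 by move: X0A; rewrite inE => /andP[].
have zS : z \in S.
  have := card_swapI S zX0 eX0; rewrite (SB _ _ XB Y0B) (negPf eS) addn0.
  by case: (z \in S) => // h; rewrite -h addn0 ltnn in lt0.
pose mix Z := (Z :\: S) :|: (swap X0 z e :&: S).
have ez : e != z by apply: contraNneq eS => ->.
have mixP Z : Z \in B -> swap (mix Z) e z \in A.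
  move=> ZB; have mB : mix Z \in B by apply: exchange_mix.
  have zm : z \notin mix Z by rewrite !inE zS eqxx /= eq_sym (negPf ez).
  have mM : mix Z \in M by apply: (subsetP (con_sub M e)).
  have X0M : X0 \in M by apply: (subsetP (del_sub M e)).
  have [|u] := exchange_out exM cM mM X0M (y := z); first by rewrite in_setD zm.
  rewrite in_setD => /andP[uX0 um] ZM.
  have [ue|ue] := eqVneq u e.
    by rewrite -ue !inE ZM ue eqxx /= (negPf ez).
  have em : e \in mix Z by move: mB; rewrite inE => /andP[].
  have ZB' : swap (mix Z) u z \in B.
    by rewrite inE ZM in_setU1 in_setD1 em [e == u]eq_sym ue orbT.
  have uS : u \in S.
    have := card_swapI S um zm; rewrite (SB _ _ ZB' mB) zS.
    by case: (u \in S) => // /addnI.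
  by move: um; rewrite !inE uS (negPf uX0) (negPf ue) !andbF.
have xz : x != z by apply: contraNneq xS => ->.
have yz : y != z by apply: contraNneq yS => ->.
have eY : e \in Y by move: YB; rewrite inE => /andP[].
have eY' : e \in swap Y x y by move: YB'; rewrite inE => /andP[].
have ye : y != e by apply: contraNneq yY => ->.
have xe : x != e.
  by apply: contraTneq eY' => ->; rewrite !inE eqxx orbF eq_sym.
apply/adjacentP; exists (swap (mix Y) e z); split; first exact: mixP.
- by rewrite !inE xe xS xY orbT.
- by rewrite !inE (negPf yz) (negPf yS) (negPf yY) !andbF.
- suff -> : swap (swap (mix Y) e z) x y = swap (mix (swap Y x y)) e z by exact: mixP.
  apply/setP => t; rewrite !inE.
  case: (eqVneq t y) => [->|ty] /=.
    by rewrite (negPf yz) yS ye.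
  by case: (eqVneq t x) => [->|tx] //=; rewrite (negPf xz) (negPf xS) !andbF.
Qed.

End Transfer.
End Exchange.

(** * Cells of a lifting *)

Section Cells.
Variables (R : realFieldType) (T : finType).
Implicit Types (P : pred {set T}) (v w : {set T} -> R) (c g : T -> R).
Implicit Types (A M : {set {set T}}) (C U S X Y : {set T}).

Definition minimizers P v := [set X | P X & [forall Y, P Y ==> (v X <= v Y)]].

Lemma minimizersP P v X :
  reflect (P X /\ forall Y, P Y -> v X <= v Y) (X \in minimizers P v).
Proof.
rewrite inE; apply: (iffP andP) => -[PX H]; split=> //.
  by move=> Y PY; move/forallP: H => /(_ Y); rewrite PY.
by apply/forallP => Y; apply/implyP; exact: H.
Qed.

Lemma minimizers_ex P v X : P X -> exists Y, Y \in minimizers P v.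
Proof.
by move=> PX; case: (arg_minP v PX) => Y PY minY; exists Y; apply/minimizersP.
Qed.

(** The height of a vertex after tilting the lifting by a linear functional. The coefficients [c]
    are those of a functional defining a lower face, scaled to have last coordinate 1. *)
Definition weight w c X := w X + \sum_(x in X) c x.

Lemma weightB w c s g X :
  weight w (fun x => c x - s * g x) X = weight w c X - s * \sum_(x in X) g x.
Proof. by rewrite /weight sumrB -mulr_sumr addrA. Qed.

(* Decrease v along the functional k until a new minimizer appears. *)
Lemma minimizers_shoot P v (k : {set T} -> R) X0 X1 :
  X0 \in minimizers P v -> P X1 -> k X0 < k X1 ->
  exists s X, [/\ X \in minimizers P (fun Y => v Y - s * k Y), k X0 < k X &
    forall Y, Y \in minimizers P v -> k Y = k X0 ->
      Y \in minimizers P (fun Y => v Y - s * k Y)].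
Proof.
move=> /minimizersP[PX0 minX0] PX1 kX1.
have PX1' : P X1 && (k X0 < k X1) by rewrite PX1.
(* The least ratio is the largest tilt [s] for which [X0] remains a minimizer. *)
case: (@arg_minP _ _ _ X1 (fun X => P X && (k X0 < k X))
  (fun X => (v X - v X0) / (k X - k X0)) PX1') => X.
move=> /andP[PX kX] minX; pose s := (v X - v X0) / (k X - k X0).
have s0 : 0 <= s by rewrite divr_ge0 ?subr_ge0 ?minX0 // ltW.
have lb Y : P Y -> v X0 - s * k X0 <= v Y - s * k Y.
  move=> PY; have [kY|kY] := ltP (k X0) (k Y).
    have := minX Y; rewrite PY kY => /(_ isT).
    by rewrite -/s ler_pdivlMr ?subr_gt0 // mulrBr; lra.
  have := minX0 _ PY; have : 0 <= s * (k X0 - k Y) by rewrite mulr_ge0 ?subr_ge0.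
  by rewrite mulrBr; lra.
exists s, X; split=> //.
  apply/minimizersP; split=> // Y /lb; apply: le_trans.
  have : s * (k X - k X0) = v X - v X0.
    by rewrite divfK // subr_eq0 gt_eqF.
  by rewrite mulrBr; lra.
move=> Y /minimizersP[PY minY] kY; apply/minimizersP; split=> // Z /lb.
by apply: le_trans; rewrite kY lerB // minY.
Qed.

(** These index the vertices of a face of the hypersimplex; on matroids, passing to it contracts [C]
    and deletes the complement of [U]. *)
Definition dinterval C U d : pred {set T} :=
  fun X => [&& C \subset X, X \subset U & #|X| == d].

Lemma dinterval_ex C U d : C \subset U -> (#|C| <= d <= #|U|)%N ->
  exists X, dinterval C U d X.
Proof.
move=> CU /andP[]; elim: d => [|d IH] Cd dU.
  exists C; apply/and3P; split=> //.
  by move: Cd; rewrite leqn0.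
move: Cd; rewrite leq_eqVlt => /orP[/eqP Cd|Cd].
  by exists C; apply/and3P; split=> //; rewrite Cd.
have [X /and3P[CX XU /eqP dX]] := IH Cd (ltnW dU).
have [|[x]] := set_0Vmem (U :\: X).
  by move=> /eqP; rewrite setD_eq0 => /subset_leq_card; rewrite dX leqNgt dU.
rewrite inE => /andP[xX xU]; exists (x |: X); apply/and3P; split.
- by apply: subset_trans CX _; apply: subsetUr.
- by rewrite subUset sub1set xU.
- by rewrite cardsU1 xX dX.
Qed.

Lemma dinterval_swap C U d X x y : dinterval C U d X -> x \in X -> x \notin C ->
  y \notin X -> y \in U -> dinterval C U d (swap X x y).
Proof.
move=> /and3P[CX XU dX] xX xC yX yU; apply/and3P; split.
- apply/subsetP => z zC; rewrite !inE (subsetP CX _ zC) andbT.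
  by apply/orP; right; apply: contraNneq xC => <-.
- rewrite subUset sub1set yU /=; apply: subset_trans XU; exact: subD1set.
- by rewrite card_swap.
Qed.

Lemma dinterval_equicard C U d v : equicard (minimizers (dinterval C U d) v).
Proof. by exists d => X /minimizersP[/and3P[_ _ /eqP]]. Qed.

End Cells.

(** * Splitting a cell at an element *)

Section Splitting.
Variables (R : realFieldType) (T : finType) (w : {set T} -> R).
Variables (C U : {set T}) (d : nat) (e : T).
Hypotheses (CU : C \subset U) (Cd : (#|C| + 2 <= d)%N) (dU : (d + 2 <= #|U|)%N).
Hypothesis eUC : e \in U :\: C.
Implicit Types (c g : T -> R) (S F X Y : {set T}).

Let P := dinterval C U d.
Let E := (U :\: C) :\ e.
Let cell c := minimizers P (weight w c).
Let A c := del (cell c) e.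
Let B c := con (cell c) e.

Hypothesis cell_exchange : forall c, exchange (cell c).

(** This says that the contraction of the cell is connected on [E]. *)
Let trivial_con c := forall S, S \subset E -> const_card (B c) S -> S = set0 \/ S = E.

Lemma con_cellE c : (exists X, X \in B c) ->
  B c = minimizers (fun X => P X && (e \in X)) (weight w c).
Proof.
move=> [X0]; rewrite inE => /andP[/minimizersP[PX0 minX0] eX0].
apply/setP => X; rewrite inE; apply/andP/minimizersP.
  by move=> [/minimizersP[PX minX] eX]; split=> [|Y /andP[/minX]//]; rewrite PX.
move=> [/andP[PX eX] minX]; split=> //; apply/minimizersP; split=> // Y PY.
by apply: le_trans (minX X0 _) (minX0 _ PY); rewrite PX0.
Qed.

Lemma mem_A c X : X \in A c -> [/\ C \subset X, X \subset U, #|X| = d & e \notin X].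
Proof. by rewrite inE => /andP[/minimizersP[/and3P[? ? /eqP ?] _] ?]. Qed.

Lemma mem_B c X : X \in B c -> [/\ C \subset X, X \subset U, #|X| = d & e \in X].
Proof. by rewrite inE => /andP[/minimizersP[/and3P[? ? /eqP ?] _] ?]. Qed.

(** Changing the coefficient of [e] shifts all sets containing [e] by the same amount. So the minima
    over the sets with and without [e] can be made equal, while the cell of the face [e \in X] stays
    the same. *)
Lemma balance c : exists c',
  [/\ exists X, X \in A c', exists X, X \in B c' &
      B c' = minimizers (fun X => P X && (e \in X)) (weight w c)].
Proof.
move: (eUC); rewrite inE => /andP[eC eU].
have [X1 PX1] : exists X, dinterval (e |: C) U d X.
  apply: dinterval_ex; first by rewrite subUset sub1set eU.
  by rewrite cardsU1 eC; lia.
have [X0 PX0] : exists X, dinterval C (U :\ e) d X.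
  apply: dinterval_ex; first by rewrite subsetD1 CU.
  have := cardsD1 e U; rewrite eU add1n => h; move: (dU).
  by rewrite h => dU'; apply/andP; split; lia.
have {}PX1 : P X1 && (e \in X1).
  move/and3P: PX1; rewrite subUset sub1set => -[/andP[eX ?] ? ?].
  by rewrite eX andbT; apply/and3P.
have {}PX0 : P X0 && (e \notin X0).
  move/and3P: PX0; rewrite subsetD1 => -[? /andP[? eX] ?].
  by rewrite eX andbT; apply/and3P.
have [Y1 Y1m] := @minimizers_ex _ _ (fun X => P X && (e \in X)) (weight w c) _ PX1.
have [Y0 Y0m] := @minimizers_ex _ _ (fun X => P X && (e \notin X)) (weight w c) _ PX0.
have /minimizersP[/andP[PY1 eY1] minY1] := Y1m.
have /minimizersP[/andP[PY0 eY0] minY0] := Y0m.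
pose t := weight w c Y1 - weight w c Y0.
pose c' x := c x - t * (x == e)%:R.
have w' X : weight w c' X = weight w c X - t * (e \in X)%:R.
  rewrite weightB; congr (_ - _ * _).
  have [eX|eX] := boolP (e \in X).
    by rewrite (big_setD1 e) //= eqxx big1 ?addr0 // => x; rewrite !inE => /andP[/negPf ->].
  by rewrite big1 // => x xX; case: eqVneq => // xe; rewrite -xe xX in eX.
have Y0c : Y0 \in cell c'.
  apply/minimizersP; split=> // X PX; rewrite !w' (negPf eY0) mulr0 subr0.
  have [eX|eX] := boolP (e \in X); last by rewrite mulr0 subr0 minY0 // PX.
  by have := minY1 X; rewrite PX eX mulr1 => /(_ isT); rewrite /t; lra.
have Y1c : Y1 \in cell c'.
  move/minimizersP: Y0c => [_ minY0']; apply/minimizersP; split=> // X PX.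
  by apply: le_trans (minY0' X PX); rewrite !w' eY1 (negPf eY0) mulr0 mulr1 /t; lra.
have B1 : exists X, X \in B c' by exists Y1; rewrite inE Y1c.
exists c'; split=> //; first by exists Y0; rewrite inE Y0c.
rewrite con_cellE //; apply/setP => X; apply/minimizersP/minimizersP.
  move=> [PX minX]; split=> // Y PY; have := minX Y PY; rewrite !w'.
  by case/andP: PX => _ ->; case/andP: PY => _ ->; lra.
move=> [PX minX]; split=> // Y PY; have := minX Y PY; rewrite !w'.
by case/andP: PX => _ ->; case/andP: PY => _ ->; lra.
Qed.

Let constb (D : {set {set T}}) S :=
  [forall X in D, forall Y in D, #|X :&: S| == #|Y :&: S|].

Let constP D S : reflect (const_card D S) (constb D S).
Proof.
apply: (iffP forall_inP) => [H X Y XD YD|H X XD].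
  by apply/eqP; move/forall_inP: (H X XD); exact.
by apply/forall_inP => Y YD; apply/eqP; exact: H.
Qed.

(** The number of these separators is the measure that decreases in both descents below, for [B c]
    first and for [A c] later. *)
Let const_sets D := [set S : {set T} | (S \subset E) && constb D S].

Lemma sum_setI X S : \sum_(x in X) (x \in S)%:R = #|X :&: S|%:R :> R.
Proof. by rewrite card_setI_sum natr_sum. Qed.

(** While [B c] has a nontrivial separator [S], tilting along the indicator of [S] inside the face
    [e \in X] keeps all of [B c] and adds a set with a different count in [S]. No separator is
    gained and [S] is lost. Then [balance] makes the cell meet both sides again. *)
Lemma trivial_con_ex : exists c,
  [/\ exists X, X \in A c, exists X, X \in B c & trivial_con c].
Proof.
have [k] := ubnP #|const_sets (B (fun=> 0))|.
have [c0 []] := balance (fun=> 0).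
suff H m c : (#|const_sets (B c)| < m)%N -> (exists X, X \in A c) ->
    (exists X, X \in B c) ->
    exists c, [/\ exists X, X \in A c, exists X, X \in B c & trivial_con c].
  by move=> ? ? _ _; apply: (H _ c0 (ltnSn _)).
elim: m c => // m IH c ltm Ac [X0 X0B].
have [/forall_inP tc|] := boolP [forall S in const_sets (B c), (S == set0) || (S == E)].
  exists c; split=> //; first by exists X0.
  move=> S SE /constP Sc; have := tc S; rewrite inE SE Sc => /(_ isT).
  by move=> /orP[/eqP|/eqP]; [left|right].
rewrite negb_forall_in => /exists_inP[S]; rewrite inE => /andP[SE /constP Sc].
rewrite negb_or => /andP[S0 S1].
have [CX0 X0U dX0 eX0] := mem_B X0B.
have EE x : x \in E -> [/\ x != e, x \notin C & x \in U].
  by rewrite !inE => /and3P[].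
(* If all sets containing [e] had the same count in [S], swaps at [X0] would make [S] empty or all
   of [E]; [Cd] and [dU] provide elements of [E] inside and outside [X0]. *)
have [X1 /andP[/andP[PX1 eX1] nX1]] :
    exists X1, (P X1 && (e \in X1)) && (#|X1 :&: S| != #|X0 :&: S|).
  apply/existsP; apply: contraT => /existsPn nex.
  have same x y : x \in E -> y \in E -> x \in X0 -> y \notin X0 -> (x \in S) = (y \in S).
    move=> /EE[xe xC _] /EE[_ _ yU] xX yX; have := nex (swap X0 x y).
    have PX0 : P X0 by apply/and3P; split=> //; apply/eqP.
    have ex : e \in swap X0 x y by rewrite in_setU1 in_setD1 eX0 eq_sym [e == x]eq_sym xe orbT.
    have PX : P (swap X0 x y) := dinterval_swap PX0 xX xC yX yU.
    rewrite PX ex /= negbK => /eqP h.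
    have := card_swapI S xX yX; rewrite h => /addnI.
    by case: (x \in S); case: (y \in S).
  have [x1 x1E x1X] : exists2 x, x \in E & x \in X0.
    have [D0|[x]] := set_0Vmem (X0 :\: (e |: C)).
      move/eqP: D0; rewrite setD_eq0 => /subset_leq_card; rewrite cardsU1 dX0 => h.
      have := leq_trans Cd (leq_trans h (leq_add (leq_b1 _) (leqnn _))).
      by rewrite [(1 + _)%N]addnC leq_add2l.
    rewrite !inE negb_or => /andP[/andP[xe xC] xX].
    by exists x; rewrite // !inE xe xC (subsetP X0U).
  have [y1 y1E y1X] : exists2 y, y \in E & y \notin X0.
    have [D0|[y]] := set_0Vmem (U :\: X0).
      move/eqP: D0; rewrite setD_eq0 => /subset_leq_card; rewrite dX0 => h.
      by have := leq_trans dU h; rewrite -[X in (_ <= X)%N]addn0 leq_add2l.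
    rewrite inE => /andP[yX yU].
    exists y; rewrite // !inE yU andbT; apply/andP; split.
      by apply: contraNneq yX => ->.
    by apply: contraNN yX; apply: (subsetP CX0).
  have all x : x \in E -> (x \in S) = (y1 \in S).
    move=> xE; have [xX|xX] := boolP (x \in X0); first exact: same.
    by rewrite -(same x1 x) // (same x1 y1).
  have [y1S|y1S] := boolP (y1 \in S).
    case/negP: S1; rewrite eqEsubset SE; apply/subsetP => x /all ->.
    by rewrite y1S.
  case/negP: S0; rewrite -subset0; apply/subsetP => x xS.
  by rewrite -(all x) ?xS // in y1S; exact: (subsetP SE).
(* The sign orients the tilt so that [X1] lies on its increasing side. *)
pose sg : R := if (#|X0 :&: S| < #|X1 :&: S|)%N then 1 else -1.
pose g x : R := sg * (x \in S)%:R.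
have gE X : \sum_(x in X) g x = sg * #|X :&: S|%:R.
  by rewrite -mulr_sumr sum_setI.
have BE := con_cellE (ex_intro _ X0 X0B).
have X0m : X0 \in minimizers (fun X => P X && (e \in X)) (weight w c) by rewrite -BE.
have [||s [X [Xm kX keep]]] :=
    minimizers_shoot (k := fun X => \sum_(x in X) g x) (X1 := X1) X0m.
- by rewrite PX1.
- rewrite !gE /sg; case: ltnP => h; first by rewrite !mul1r ltr_nat.
  by rewrite !mulN1r ltrN2 ltr_nat ltn_neqAle nX1.
pose c1 x := c x - s * g x.
have eqm : minimizers (fun X => P X && (e \in X)) (weight w c1) =
  minimizers (fun X => P X && (e \in X)) (fun Y => weight w c Y - s * \sum_(x in Y) g x).
  apply/setP => Y; rewrite !inE weightB; congr (_ && _).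
  by apply: eq_forallb => Z; rewrite weightB.
have [c2 [Ac2 Bc2 B2E]] := balance c1.
apply: (IH c2) => //; rewrite ltnS in ltm; apply: leq_trans ltm.
rewrite B2E eqm; apply/proper_card/properP; split.
  apply/subsetP => Q; rewrite !inE => /andP[-> /constP Qc]; apply/constP => Y Z YB ZB.
  have SY Y' : Y' \in B c -> \sum_(x in Y') g x = \sum_(x in X0) g x.
    by move=> YB'; rewrite !gE (Sc _ _ YB' X0B).
  by apply: Qc; apply: keep; rewrite -?BE // SY.
exists S; first by rewrite inE SE; apply/constP.
rewrite inE SE; apply/negP => /constP Sc'.
have := kX; rewrite !gE (Sc' X X0) ?ltxx //; exact: keep.
Qed.

Let exA c : exchange (A c) := exchange_del (cell_exchange (c := c)).
Let exB c : exchange (B c) := exchange_con (cell_exchange (c := c)).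
Let cardc c : equicard (cell c) := @dinterval_equicard R T C U d (weight w c).
Let cardA c : equicard (A c) := equicard_sub (del_sub _ e) (cardc c).
Let cardB c : equicard (B c) := equicard_sub (con_sub _ e) (cardc c).

Lemma adjacent_A c x y : adjacent (A c) x y -> (x \in E) /\ (y \in E).
Proof.
move=> /adjacentP[X [/mem_A[CX XU _ eX] xX yX /mem_A[CX' XU' _ eX']]].
have yX' : y \in swap X x y by rewrite in_setU1 eqxx.
have xX' : x \notin swap X x y.
  by rewrite in_setU1 in_setD1 eqxx orbF; apply: contraNneq yX => <-.
rewrite !in_setD1 !in_setD (subsetP XU _ xX) (subsetP XU' _ yX') !andbT.
split; apply/andP; split.
- by apply: contraNneq eX => <-.
- by apply: contraNN xX'; exact: (subsetP CX').
- by apply: contraNneq eX' => <-.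
- by apply: contraNN yX; exact: (subsetP CX).
Qed.

Lemma adjacent_B c x y : adjacent (B c) x y -> (x \in E) /\ (y \in E).
Proof.
move=> /adjacentP[X [/mem_B[CX XU _ eX] xX yX /mem_B[CX' XU' _ eX']]].
have yX' : y \in swap X x y by rewrite in_setU1 eqxx.
have xX' : x \notin swap X x y.
  by rewrite in_setU1 in_setD1 eqxx orbF; apply: contraNneq yX => <-.
rewrite !in_setD1 !in_setD (subsetP XU _ xX) (subsetP XU' _ yX') !andbT.
split; apply/andP; split.
- by apply: contraTneq eX' => <-.
- by apply: contraNN xX'; exact: (subsetP CX').
- by apply: contraTneq eX => <-.
- by apply: contraNN yX; exact: (subsetP CX).
Qed.

Let comp c x := [set y | connect (adjacent (A c)) x y].

Let comp_refl c x : x \in comp c x.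
Proof. by rewrite inE connect0. Qed.

Let comp_adj c z x y : adjacent (A c) x y -> (x \in comp c z) = (y \in comp c z).
Proof.
move=> xy; rewrite !inE.
exact: (same_connect1r (sym_connect_sym (@adjacent_sym _ _)) xy).
Qed.

Let comp_const c x : const_card (A c) (comp c x).
Proof. by apply: adjacent_const_card => // y z; exact: comp_adj. Qed.

Let comp_sub c x : x \in E -> comp c x \subset E.
Proof.
move=> xE; apply/subsetP => y; rewrite inE => xy.
have cl : closed (adjacent (A c)) (mem E) by move=> z t /adjacent_A[-> ->].
by rewrite -(closed_connect cl xy).
Qed.

Let comp_disj c x y z : y \notin comp c x -> z \in comp c x -> z \notin comp c y.
Proof.
rewrite !inE => yx xz; apply: contraNN yx => yz; apply: connect_trans xz _.
by rewrite (sym_connect_sym (@adjacent_sym _ _)).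
Qed.

(** The level sets of [g] on [E] are separators of [B c], hence trivial. *)
Let trivial_con_const c (g : T -> R) x y : trivial_con c ->
  const_on (B c) g -> x \in E -> y \in E -> g x = g y.
Proof.
move=> tc gB xE yE; pose Q := [set z in E | g z == g x].
have [||Q0|QE] := tc Q; first by apply/subsetP => z; rewrite in_set => /andP[].
- apply: adjacent_const_card => // z t zt; have [zE tE] := adjacent_B zt.
  by rewrite /Q 2!in_set zE tE (const_on_adjacent gB zt).
- by have : x \in Q by [rewrite in_set xE eqxx]; rewrite Q0 in_set0.
- by move: yE; rewrite -QE in_set => /andP[_ /eqP].
Qed.

Definition split_by c F := forall g : T -> R, const_on (A c) g \/ const_on (B c) g ->
  forall x y, x \in E -> y \in E -> (x \in F) = (y \in F) -> g x = g y.

(** Let [S] be a component of the deletion. If there are at most two components, [F := S] works.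
    Otherwise tilting along the indicator of [S] keeps the deletion and those sets of the
    contraction whose count in [S] is the rank [k] of [S], and adds a set with a larger count. The
    kept sets force every functional constant on the new contraction to be constant on [S] and on
    [E :\: S]. Either [S] is a separator of the new contraction, and then [S] splits the new cell,
    or that contraction is connected and the deletion has lost the separator [S]. *)
Lemma split_descent c : (exists X, X \in A c) -> (exists X, X \in B c) ->
  trivial_con c -> (exists F, split_by c F) \/
  exists c', [/\ exists X, X \in A c', exists X, X \in B c' &
    (exists F, split_by c' F) \/
    (trivial_con c' /\ const_sets (A c') \proper const_sets (A c))].
Proof.
move=> [Y0 Y0A] [Z0 Z0B] tc.
have [CY0 Y0U dY0 eY0] := mem_A Y0A.
(* Taking [x0] outside [Y0] makes it possible to swap it in later, which raises the count in its
   component. *)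
have [x0 x0E x0Y0] : exists2 x, x \in E & x \notin Y0.
  have [D0|[x]] := set_0Vmem (U :\: (e |: Y0)).
    move/eqP: D0; rewrite setD_eq0 => /subset_leq_card; rewrite cardsU1 eY0 dY0 => h.
    by have := leq_trans dU h; rewrite addnC leq_add2r.
  rewrite !inE negb_or => /andP[/andP[xe xY0] xU]; exists x; rewrite // !inE xe xU andbT.
  by apply: contraNN xY0; exact: (subsetP CY0).
pose S := comp c x0.
have SE : S \subset E by exact: comp_sub.
have x0S : x0 \in S by exact: comp_refl.
have Sc : const_card (A c) S by exact: comp_const.
have eE : e \notin E by rewrite !inE eqxx.
have [/existsP[x1 /forall_inP two]|/existsPn many] :=
    boolP [exists x1, [forall y in E, (y \in S) || (y \in comp c x1)]].
  left; exists S => g [gA|gB] x y xE yE; last by move=> _; exact: trivial_con_const gB xE yE.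
  have con z t : t \in comp c z -> g z = g t.
    by rewrite inE; exact: const_on_connect.
  have := two x xE; have := two y yE.
  have [xS _ _ /esym yS|xS] := boolP (x \in S).
    by rewrite -(con x0 x xS) (con x0 y yS).
  by move=> + /= xx1 /esym yS; rewrite yS /= => yx1; rewrite -(con _ _ xx1) (con _ _ yx1).
right.
have {}many x : exists2 y, y \in E & (y \notin S) && (y \notin comp c x).
  have := many x; rewrite negb_forall_in => /exists_inP[y yE]; rewrite negb_or.
  by move=> ?; exists y.
(* Every component other than [S] loses rank in the contraction; otherwise it would be a nontrivial
   separator of [B c]. *)
have compB y : y \in E -> y \notin S ->
    exists2 X, X \in B c & (#|X :&: comp c y| < #|Y0 :&: comp c y|)%N.
  move=> yE yS; apply/exists_inP; apply: contraT => /exists_inPn ge.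
  have eqc X : X \in B c -> #|X :&: comp c y| = #|Y0 :&: comp c y|.
    move=> XB; have := ge X XB; rewrite -leqNgt => leX.
    apply/eqP; rewrite eqn_leq leX andbT.
    have [u uYX XA] := con_to_del (@cell_exchange c) XB Y0A.
    have eX : e \in X by have [] := mem_B XB.
    have uX : u \notin X by move: uYX; rewrite inE => /andP[].
    have := card_swapI (comp c y) eX uX; rewrite (@comp_const c y _ _ XA Y0A).
    have -> : (e \in comp c y) = false.
      by apply/negbTE; apply: contraNN eE; apply/subsetP/comp_sub.
    by rewrite addn0 => ->; exact: leq_addr.
  have [||D0|DE] := tc (comp c y); first exact: comp_sub.
  - by move=> X X' XB XB'; rewrite !eqc.
  - by have := comp_refl c y; rewrite D0 inE.
  - have : x0 \in comp c y by rewrite DE.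
    move=> x0y; have := comp_disj (c := c) (x := x0) yS x0S.
    by rewrite x0y.
pose k := #|Y0 :&: S|.
(* If [X] is deficient in the component of [y], then replacing [e] brings in an element of that
   component, so the count in [S] already equals [k]. *)
have compG y X : y \in E -> y \notin S -> X \in B c ->
    (#|X :&: comp c y| < #|Y0 :&: comp c y|)%N ->
    #|X :&: S| = k /\ exists2 u, u \in comp c y & forall g : T -> R, const_on (A c) g ->
      \sum_(z in X) g z + g u = \sum_(z in Y0) g z + g e.
  move=> yE yS XB ltX.
  have [u uYX XA] := con_to_del (@cell_exchange c) XB Y0A.
  have eX : e \in X by have [] := mem_B XB.
  have uX : u \notin X by move: uYX; rewrite inE => /andP[].
  have ec t : t \in E -> (e \in comp c t) = false.
    by move=> tE; apply/negbTE; apply: contraNN eE; apply/subsetP/comp_sub.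
  have uy : u \in comp c y.
    have := card_swapI (comp c y) eX uX; rewrite (@comp_const c y _ _ XA Y0A) ec // addn0.
    by case: (u \in comp c y) => // h; rewrite h addn0 ltnn in ltX.
  have uS : u \notin S.
    by apply/negP => uS; have := comp_disj yS uS; rewrite uy.
  split.
    have := card_swapI S eX uX; rewrite (Sc _ _ XA Y0A) ec // (negPf uS) !addn0.
    by move=> <-.
  exists u => // g gA; have := big_swap g eX uX.
  by rewrite (gA _ _ XA Y0A) => <-.
have [y0 y0E /andP[y0S _]] := many x0.
have [G0 G0B ltG0] := compB _ y0E y0S.
have [G0S [u0 u0y0 _]] := compG _ _ y0E y0S G0B ltG0.
have G0c : G0 \in cell c by move: G0B; rewrite inE => /andP[].
(* The sets X of B c with #|X :&: S| = k stay minimizing across the wall. *)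
have faceS (h : T -> R) : (forall X X', X \in B c -> X' \in B c ->
      #|X :&: S| = k -> #|X' :&: S| = k -> \sum_(z in X) h z = \sum_(z in X') h z) ->
    forall x y, x \in E -> y \in E -> (x \in S) = (y \in S) -> h x = h y.
  move=> hG.
  have hadj x y : adjacent (A c) x y -> h x = h y.
    (* A component other than [S] and that of [x] makes room for [e]; the exchange of [x] for [y]
       then happens between two sets with count [k] in [S]. *)
    move=> xy; have [t tE /andP[tS tx]] := many x.
    have [X XB ltX] := compB _ tE tS.
    have xt : x \notin comp c t by exact: comp_disj tx (comp_refl c x).
    have yt : y \notin comp c t by rewrite -(comp_adj _ xy).
    have et : e \notin comp c t by apply: contraNN eE; apply/subsetP/comp_sub.
    have [Z [ZB xZ yZ ZB' ltZ]] := adjacent_del_con (@cell_exchange c) (cardc c)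
      (@comp_const c t) et XB Y0A ltX xt yt xy.
    have [ZS _] := compG _ _ tE tS ZB ltZ.
    have [|ZS' _] := compG _ _ tE tS ZB'.
      have := card_swapI (comp c t) xZ yZ; rewrite (negPf xt) (negPf yt) !addn0.
      by move=> ->.
    have := big_swap h xZ yZ; rewrite (hG _ _ ZB ZB' ZS ZS') => /addrI.
    by [].
  have hA : const_on (A c) h.
    by apply: adjacent_const_on => // u v a /addIr.
  have con z t : t \in comp c z -> h z = h t.
    by rewrite inE; exact: const_on_connect.
  move=> x y xE yE; have [xS /esym yS|xS /esym /negbT yS] := boolP (x \in S).
    by rewrite -(con x0 x xS) (con x0 y yS).
  (* Two components outside [S] are compared by letting [e] replace an element of the one or of the
     other. *)
  have [X XB ltX] := compB _ xE xS; have [X' XB' ltX'] := compB _ yE yS.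
  have [XS [u ux uE]] := compG _ _ xE xS XB ltX.
  have [XS' [u' uy' uE']] := compG _ _ yE yS XB' ltX'.
  have := uE h hA; rewrite -(uE' h hA) (hG _ _ XB XB' XS XS') => /addrI huu.
  by rewrite (con _ _ ux) (con _ _ uy').
have [X1 PX1 kX1] : exists2 X1, P X1 & (k < #|X1 :&: S|)%N.
  have : (0 < #|Y0 :&: comp c y0|)%N by apply: leq_trans ltG0.
  rewrite card_gt0 => /set0Pn[y]; rewrite inE => /andP[yY0 yc].
  have yE : y \in E by apply: (subsetP (comp_sub c y0E)).
  have yS : y \notin S by apply/negP => yS; have := comp_disj y0S yS; rewrite yc.
  exists (swap Y0 y x0).
    apply: dinterval_swap => //.
    - by apply/and3P; split=> //; apply/eqP.
    - by move: yE; rewrite !inE => /and3P[].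
    - by move: x0E; rewrite !inE => /and3P[].
  have := card_swapI S yY0 x0Y0; rewrite x0S (negPf yS) addn0 => ->.
  by rewrite addn1.
pose g x : R := (x \in S)%:R.
have gE X : \sum_(x in X) g x = #|X :&: S|%:R by exact: sum_setI.
have Y0c : Y0 \in cell c by move: Y0A; rewrite inE => /andP[].
have [|s [X' [X'm kX' keep]]] :=
    minimizers_shoot (k := fun X => \sum_(x in X) g x) (X1 := X1) Y0c PX1.
  by rewrite !gE ltr_nat.
pose c' x := c x - s * g x.
have eqm : cell c' = minimizers P (fun Y => weight w c Y - s * \sum_(x in Y) g x).
  apply/setP => Y; rewrite !inE weightB; congr (_ && _).
  by apply: eq_forallb => Z; rewrite weightB.
rewrite -eqm in X'm.
have {}kX' : (k < #|X' :&: S|)%N by move: kX'; rewrite !gE ltr_nat.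
have {}keep Y : Y \in cell c -> #|Y :&: S| = k -> Y \in cell c'.
  by move=> Yc kY; rewrite eqm; apply: keep => //; rewrite !gE kY.
have AA' : A c \subset A c'.
  apply/subsetP => Y YA; have /setIdP[Yc eY] := YA; apply/setIdP; split=> //.
  by apply: keep => //; exact: Sc.
have BB' X : X \in B c -> #|X :&: S| = k -> X \in B c'.
  by move=> /setIdP[Xc eX] kX; apply/setIdP; split=> //; exact: keep.
have faceB (h : T -> R) : const_on (B c') h ->
    forall x y, x \in E -> y \in E -> (x \in S) = (y \in S) -> h x = h y.
  by move=> hB'; apply: faceS => X X'' XB XB'' kX kX''; apply: hB'; apply: BB'.
have AU Y : Y \in A c' -> #|Y :&: E| = (d - #|C|)%N.
  move=> /mem_A[CY YU dY eY]; rewrite -dY -cardsDS //; congr #|pred_of_set _|.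
  apply/setP => z; rewrite !inE; case: (boolP (z \in Y)) => zY; rewrite ?andbF //=.
  rewrite (subsetP YU) // !andbT; case: (eqVneq z e) => [ze|] //=.
  by rewrite ze (negPf eY) in zY.
have BU Y : Y \in B c' -> #|Y :&: E|.+1 = (d - #|C|)%N.
  move=> /mem_B[CY YU dY eY]; rewrite -dY -cardsDS // (cardsD1 e (Y :\: C)).
  move: (eUC); rewrite !inE eY => /andP[-> _]; rewrite add1n; congr (#|pred_of_set _|.+1).
  apply/setP => z; rewrite !inE; case: (boolP (z \in Y)) => zY; rewrite ?andbF //=.
  by rewrite (subsetP YU) // !andbT.
exists c'; split; first by exists Y0; exact: (subsetP AA').
  by exists G0; exact: BB'.
(* If [S] is a separator of [B c'], exchanges of [B c'] pass to [A c']: those outside [S] by means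
   of the separator [S], those inside by means of [E :\: S]. So a functional constant on [A c'] is
   constant on [B c'] too. *)
have [/constP SB'|/constP SB'] := boolP (constb (B c') S).
  left; exists S => h [hA'|]; last exact: faceB.
  apply: faceB; apply: adjacent_const_on => //; last by move=> u v a /addIr.
  move=> x y xy; apply: (const_on_adjacent hA').
  have [xE yE] := adjacent_B xy.
  have X'A : X' \in A c'.
    apply/setIdP; split=> //; apply: contraL kX' => eX'; rewrite -leqNgt.
    have X'B : X' \in B c' by apply/setIdP.
    by rewrite (SB' _ _ X'B (BB' _ G0B G0S)) G0S.
  have eS : e \notin S by apply: contraNN eE; exact: (subsetP SE).
  have xyS := const_card_adjacent SB' xy.
  have [xS|xS] := boolP (x \in S); last first.
    apply: (adjacent_con_del (@cell_exchange c') (cardc c') SB' eS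
      X'A (BB' _ G0B G0S) _ xS _ xy).
      by rewrite G0S.
    by rewrite -xyS.
  have DS Y : #|Y :&: (E :\: S)| = (#|Y :&: E| - #|Y :&: S|)%N.
    rewrite setIDA cardsD; congr (_ - #|pred_of_set _|)%N.
    by rewrite -setIA (setIidPr SE).
  have SB2 : const_card (B c') (E :\: S).
    move=> Y Y' YB YB'; rewrite !DS (SB' _ _ YB YB'); congr (_ - _)%N.
    by apply: succn_inj; rewrite !BU.
  apply: (adjacent_con_del (@cell_exchange c') (cardc c') SB2 _
    (subsetP AA' _ Y0A) (BB' _ G0B G0S) _ _ _ xy).
  - by rewrite !inE eqxx !andbF.
  - rewrite !DS G0S -/k (AU _ (subsetP AA' _ Y0A)) -(BU _ (BB' _ G0B G0S)).
    rewrite ltn_sub2r // ltnS -G0S; apply: subset_leq_card.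
    by apply: setIS.
  - by rewrite in_setD xS.
  - by rewrite in_setD -xyS xS.
(* By [faceB], a separator of [B c'] is empty, [S], [E :\: S] or all of [E]. The two middle cases
   are equivalent because counts in [E] are constant, and [SB'] excludes them. *)
right; split.
  move=> Q QE Qc.
  have Qb x y : x \in E -> y \in E -> (x \in S) = (y \in S) -> (x \in Q) = (y \in Q).
    move=> xE yE xyS; pose q z : R := (z \in Q)%:R.
    have : q x = q y.
      by apply: faceB => // Y Y' YB YB'; rewrite !sum_setI (Qc _ _ YB YB').
    by rewrite /q => /eqP; rewrite eqr_nat; case: (x \in Q); case: (y \in Q).
  have [x0Q|x0Q] := boolP (x0 \in Q); have [y0Q|y0Q] := boolP (y0 \in Q).
  - right; apply/eqP; rewrite eqEsubset QE; apply/subsetP => z zE.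
    have [zS|zS] := boolP (z \in S); first by rewrite (Qb z x0) // zS.
    by rewrite (Qb z y0) // (negPf zS) (negPf y0S).
  - case: SB'; suff -> : S = Q by [].
    apply/setP => z; have [zE|zE] := boolP (z \in E); last first.
      by rewrite (contraNF (subsetP SE z)) // (contraNF (subsetP QE z)).
    have [zS|zS] := boolP (z \in S); first by rewrite (Qb z x0) // zS.
    by rewrite (Qb z y0) ?(negPf y0Q) // (negPf zS) (negPf y0S).
  - case: SB' => Y Y' YB YB'.
    suff SQ : S = E :\: Q.
      have DQ Z : #|Z :&: (E :\: Q)| = (#|Z :&: E| - #|Z :&: Q|)%N.
        rewrite setIDA cardsD; congr (_ - #|pred_of_set _|)%N.
        by rewrite -setIA (setIidPr QE).
      rewrite SQ !DQ (Qc _ _ YB YB'); congr (_ - _)%N.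
      by apply: succn_inj; rewrite !BU.
    apply/setP => z; rewrite in_setD; have [zE|zE] := boolP (z \in E); last first.
      by rewrite (contraNF (subsetP SE z)) // andbF.
    have [zS|zS] := boolP (z \in S); first by rewrite (Qb z x0) ?(negPf x0Q) // zS.
    by rewrite (Qb z y0) ?y0Q // (negPf zS) (negPf y0S).
  - left; apply/eqP; rewrite -subset0; apply/subsetP => z zQ.
    have zE := subsetP QE z zQ.
    have [zS|zS] := boolP (z \in S); first by rewrite (Qb z x0) ?(negPf x0Q) ?zS // in zQ.
    by rewrite (Qb z y0) ?(negPf y0Q) ?(negPf zS) ?(negPf y0S) // in zQ.
apply/properP; split.
  apply/subsetP => Q; rewrite !inE => /andP[-> /constP Qc]; apply/constP => Y Y' YA YA'.
  by apply: Qc; exact: (subsetP AA').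
exists S; first by rewrite inE SE; apply/constP.
rewrite inE SE; apply/negP => /constP Sc'.
(* The set [X'] has more than [k] elements in [S]. If it contains [e], exchanging [e] towards [Y0]
   yields a member of [A c'] with at least as many. *)
have [eX'|eX'] := boolP (e \in X'); last first.
  have X'A : X' \in A c' by apply/setIdP.
  by have := kX'; rewrite (Sc' _ _ X'A (subsetP AA' _ Y0A)) ltnn.
have X'B : X' \in B c' by apply/setIdP.
have [u uYX XA] := con_to_del (@cell_exchange c') X'B (subsetP AA' _ Y0A).
have uX : u \notin X' by move: uYX; rewrite inE => /andP[].
have := card_swapI S eX' uX; rewrite (Sc' _ _ XA (subsetP AA' _ Y0A)).
have -> : (e \in S) = false by apply/negbTE; apply: contraNN eE; exact: (subsetP SE).
by rewrite addn0 -/k => kE; move: kX'; rewrite kE ltnNge leq_addr.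
Qed.

Lemma split_ex : exists c F,
  [/\ exists X, X \in A c, exists X, X \in B c & split_by c F].
Proof.
have [c [Ac Bc tc]] := trivial_con_ex.
have [m] := ubnP #|const_sets (A c)|.
elim: m c Ac Bc tc => // m IH c Ac Bc tc ltm.
have [[F sF]|[c' [Ac' Bc' [[F sF]|[tc' lt]]]]] := split_descent Ac Bc tc.
- by exists c, F.
- by exists c', F.
- by apply: (IH c') => //; rewrite ltnS in ltm; apply: leq_trans ltm; exact: proper_card.
Qed.

End Splitting.

(** * The upper bound on minors *)

Section Supports.
Variables (K : fieldType) (I : finType).
Local Notation V := {ffun I -> K^o}.
Implicit Types (u : V) (H : {set I}) (P : pred I).

Definition restrict_fun P u : V := [ffun i => if P i then u i else 0].

Lemma restrict_fun_linear P : linear (restrict_fun P).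
Proof.
move=> a u v; apply/ffunP => i; rewrite !ffunE.
by case: (P i) => //; rewrite scaler0 addr0.
Qed.

HB.instance Definition _ P :=
  GRing.isLinear.Build K V V _ (restrict_fun P) (restrict_fun_linear P).

Definition restrict P : 'End(V) := linfun (restrict_fun P).

Lemma restrictE P u i : restrict P u i = if P i then u i else 0.
Proof. by rewrite lfunE /= ffunE. Qed.

Definition supp_on H : {vspace V} := lker (restrict (fun i => i \notin H)).

Lemma mem_supp_on H u : u \in supp_on H <-> forall i, i \notin H -> u i = 0.
Proof.
rewrite memv_ker; split=> [/eqP h i iH|h].
  by have := restrictE (fun i => i \notin H) u i; rewrite iH h ffunE.
by apply/eqP/ffunP => i; rewrite restrictE ffunE; case: ifP => // /h.
Qed.

Lemma dim_ffun : \dim {: V} = #|I|.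
Proof. by rewrite dimvf; exact: muln1. Qed.

Lemma leq_dim_supp_on H : (\dim (supp_on H) <= #|H|)%N.
Proof.
pose dl (i : I) : V := [ffun j => (j == i)%:R].
have sub : (supp_on H <= <<[seq dl i | i in H]>>)%VS.
  apply/subvP => u /mem_supp_on uH.
  have -> : u = \sum_(i in H) u i *: dl i.
    apply/ffunP => j; rewrite sum_ffunE.
    have [jH|jH] := boolP (j \in H).
      rewrite (bigD1 j) //= !ffunE eqxx [_ *: _]mulr1 big1 ?addr0 // => i /andP[_ ij].
      by rewrite !ffunE eq_sym (negPf ij) scaler0.
    rewrite uH // big1 // => i iH; rewrite !ffunE.
    by case: eqVneq => [ji|_]; [rewrite ji iH in jH | rewrite scaler0].
  apply: memv_suml => i iH; apply/memvZ/memv_span/imageP.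
  by exists i.
apply: leq_trans (dimvS sub) (leq_trans (dim_span _) _).
by rewrite size_map -cardE.
Qed.

(** The functions supported on [H] and on its complement span the whole space, so both upper bounds
    from [leq_dim_supp_on] are attained. *)
Lemma dim_supp_on H : \dim (supp_on H) = #|H|.
Proof.
apply/eqP; rewrite eqn_leq leq_dim_supp_on /=.
have full : (fullv <= supp_on H + supp_on (~: H))%VS.
  apply/subvP => u _.
  have -> : u = restrict (mem H) u + restrict (mem (~: H)) u.
    apply/ffunP => i; rewrite ffunE !restrictE /= !inE.
    by case: (i \in H); rewrite ?addr0 ?add0r.
  apply: memv_add; apply/mem_supp_on => i; rewrite restrictE /= ?inE.
    by move=> /negPf ->.
  by rewrite negbK => ->.
have := leq_trans (dimvS full) (dimv_add_leqif _ _).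
rewrite dim_ffun -(cardsC H) => h.
by rewrite -(leq_add2r #|~: H|) (leq_trans h) // leq_add2l leq_dim_supp_on.
Qed.

Lemma dim_restrict P (W : {vspace V}) : (\dim (restrict P @: W) <= #|[set i | P i]|)%N.
Proof.
rewrite -dim_supp_on; apply/dimvS/subvP => v /memv_imgP[u _ ->].
by apply/mem_supp_on => i; rewrite inE restrictE => /negPf ->.
Qed.

End Supports.

(** * Restriction to minors and the Pascal recursion *)

Section UpperBound.
Variables (R : realFieldType) (T : finType).
Local Notation V := {ffun {set T} -> R^o}.
Variables (d : nat) (w : {set T} -> R) (W : {vspace V}).
Implicit Types (C U X : {set T}) (c : T -> R).

Let cell c := minimizers (dinterval finset.set0 [set: T] d) (weight w c).
Hypothesis cell_exchange : forall c, exchange (cell c).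
Hypothesis cell_affine : forall c u, u \in W ->
  exists (l : T -> R) (b : R), forall X, X \in cell c -> u X = \sum_(x in X) l x + b.
Hypothesis linear_in : forall a : T -> R,
  exists2 u, u \in W & forall X, #|X| = d -> u X = \sum_(x in X) a x.

(* A minor is the face of the hypersimplex on which a penalty is minimal. *)
Lemma dinterval_cell C U c X0 : dinterval C U d X0 ->
  exists c', minimizers (dinterval C U d) (weight w c) = cell c'.
Proof.
move=> iX0; have /and3P[CX0 X0U /eqP dX0] := iX0.
pose v := weight w c.
(* The penalty rate [b] exceeds every difference of values of [v], and leaving the face lowers [g]
   by at least 1. *)
pose b := 1 + \sum_X \sum_Y `|v X - v Y|.
have bP X Y : v X - v Y < b.
  have : v X - v Y <= \sum_X \sum_Y `|v X - v Y|.
    apply: le_trans (ler_norm _) _.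
    rewrite (bigD1 X) //= (bigD1 Y) //=; apply: ler_wpDr.
      by apply: sumr_ge0 => i _; exact: sumr_ge0.
    by apply: ler_wpDr => //; exact: sumr_ge0.
  by rewrite /b; lra.
have b0 : 0 <= b by have := bP X0 X0; rewrite subrr => /ltW.
pose g x : R := (x \in C)%:R - (x \notin U)%:R.
have gE X : \sum_(x in X) g x = #|X :&: C|%:R - #|X :\: U|%:R.
  rewrite sumrB sum_setI; congr (_ - _).
  rewrite setDE -sum_setI.
  by apply: eq_bigr => x _; rewrite inE.
have gI X : dinterval C U d X -> \sum_(x in X) g x = #|C|%:R.
  move=> /and3P[CX XU _]; rewrite gE (setIidPr CX).
  by move: XU; rewrite -setD_eq0 => /eqP ->; rewrite cards0 subr0.
have gN X : #|X| = d -> ~~ dinterval C U d X -> \sum_(x in X) g x <= #|C|%:R - 1.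
  move=> dX; rewrite /dinterval dX eqxx andbT negb_and gE => /orP[nCX|nXU].
    have : (#|X :&: C| < #|C|)%N.
      apply: proper_card; rewrite properE subsetIr /=.
      by apply: contraNN nCX => /subsetP h; apply/subsetP => x /h; rewrite inE => /andP[].
    by rewrite -(ler_nat R) -natr1 => ?; have := ler0n R #|X :\: U|; lra.
  have : (0 < #|X :\: U|)%N by rewrite card_gt0 setD_eq0.
  rewrite -(ler_nat R) => ?; have : (#|X :&: C| <= #|C|)%N by apply/subset_leq_card/subsetIr.
  by rewrite -(ler_nat R); lra.
have fullI X : dinterval C U d X -> dinterval finset.set0 [set: T] d X.
  by move=> /and3P[_ _ ?]; apply/and3P; rewrite sub0set subsetT.
exists (fun x => c x - b * g x); apply/setP => X; apply/minimizersP/minimizersP.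
  move=> [iX minX]; split=> [|Y]; first exact: fullI.
  move=> /and3P[_ _ /eqP dY]; rewrite !weightB (gI _ iX).
  have [iY|iY] := boolP (dinterval C U d Y).
    by rewrite (gI _ iY) lerB // minX.
  have := bP X Y; rewrite /v; have := ler_wpM2l b0 (gN _ dY iY).
  by rewrite mulrBr mulr1; lra.
move=> [/and3P[_ _ /eqP dX] minX].
have iX : dinterval C U d X.
  apply: contraT => iX; have := minX X0 (fullI _ iX0).
  rewrite !weightB (gI _ iX0); have := bP X0 X; rewrite /v.
  by have := ler_wpM2l b0 (gN _ dX iX); rewrite mulrBr mulr1; lra.
split=> // Y iY; have := minX Y (fullI _ iY).
by rewrite !weightB (gI _ iX) (gI _ iY) lerD2r.
Qed.

Local Notation minor C U := (restrict R (dinterval C U d) @: W)%VS.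

(** The two smaller minors carry the sets without and with [e], so the sum of their spaces contains
    [minor C U]. It also contains the linear functionals in [H], read on the sets without [e]. By
    the split cell these meet [minor C U] only in 0, which gains [#|H|] dimensions. *)
Lemma dim_minor_step C U e : C \subset U -> (#|C| + 2 <= d)%N -> (d + 2 <= #|U|)%N ->
  e \in U :\: C ->
  (\dim (minor C U) + (#|U :\: C| - 3) <=
    \dim (minor C (U :\ e)) + \dim (minor (e |: C) U))%N.
Proof.
move=> CU Cd dU eUC.
have [X0 iX0] : exists X, dinterval C U d X.
  apply: dinterval_ex CU _; apply/andP; split.
    exact: leq_trans (leq_addr _ _) Cd.
  exact: leq_trans (leq_addr _ _) dU.
have exch c : exchange (minimizers (dinterval C U d) (weight w c)).
  by have [c' ->] := dinterval_cell c iX0.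
have [c [F [[Y0 Y0A] [Z0 Z0B] spl]]] := split_ex CU Cd dU eUC exch.
have [c' cE] := dinterval_cell c iX0.
pose E := (U :\: C) :\ e.
(* One representative of each class of the splitting is removed from [E]. For an empty class the
   default [e] is not in [E], so that nothing is removed. *)
pose x0 := odflt e [pick x in E :&: F].
pose x1 := odflt e [pick x in E :\: F].
pose H := (E :\ x0) :\ x1.
have cardH : (#|U :\: C| - 3 <= #|H|)%N.
  rewrite (cardsD1 e (U :\: C)) eUC -/E (cardsD1 x0 E) (cardsD1 x1 (E :\ x0)) -/H.
  by rewrite !addnA leq_subLR leq_add2r; case: (x0 \in E); case: (x1 \in _).
have inI : (forall x, x \in E :&: F -> (x \in F) = (x0 \in F)) /\
    (forall x, x \in E :&: F -> x0 \in E).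
  rewrite /x0; case: pickP => [y|no] /=.
    rewrite in_setI => /andP[yE yF]; split=> x //.
    by rewrite in_setI => /andP[_ xF]; rewrite xF yF.
  by split=> x; rewrite no.
have inD : (forall x, x \in E :\: F -> (x \in F) = (x1 \in F)) /\
    (forall x, x \in E :\: F -> x1 \in E).
  rewrite /x1; case: pickP => [y|no] /=.
    rewrite in_setD => /andP[/negPf yF yE]; split=> x //.
    by rewrite in_setD => /andP[/negPf xF _]; rewrite xF yF.
  by split=> x; rewrite no.
have Hzero (a : T -> R) : (forall x, x \notin H -> a x = 0) ->
    (forall x y, x \in E -> y \in E -> (x \in F) = (y \in F) -> a x = a y) ->
    forall x, a x = 0.
  move=> a0 aF x; have [xH|/a0 //] := boolP (x \in H).
  have xE : x \in E by move: xH; rewrite 2!in_setD1 => /and3P[].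
  have [xF|xF] := boolP (x \in F).
    have xEF : x \in E :&: F by rewrite inE xE.
    have xx0 : (x \in F) = (x0 \in F) by exact: (proj1 inI).
    rewrite (aF x x0 xE (proj2 inI x xEF) xx0) a0 //.
    by rewrite !in_setD1 eqxx andbF.
  have xEF : x \in E :\: F by rewrite inE xE xF.
  have xx1 : (x \in F) = (x1 \in F) by exact: (proj1 inD).
  rewrite (aF x x1 xE (proj2 inD x xEF) xx1) a0 //.
  by rewrite in_setD1 eqxx.
pose phi (a : {ffun T -> R^o}) : V :=
  [ffun X => if dinterval C (U :\ e) d X then \sum_(x in X) a x else 0].
have phi_lin : linear phi.
  move=> k a b; apply/ffunP => X; rewrite !ffunE.
  case: ifP => _; last by rewrite scaler0 addr0.
  by rewrite scaler_sumr -big_split; apply: eq_bigr => x _; rewrite !ffunE.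
pose phiL := GRing.isLinear.Build R {ffun T -> R^o} V _ phi phi_lin.
pose Phi : 'Hom({ffun T -> R^o}, V) :=
  linfun (HB.pack_for {linear {ffun T -> R^o} -> V} phi phiL).
have PhiE a X : Phi a X = if dinterval C (U :\ e) d X then \sum_(x in X) a x else 0.
  by rewrite lfunE /= ffunE.
(* Let [l] be the linear part of [u] on the cell. As [u] vanishes on sets containing [e], [l] is
   constant on the contraction; as [u] equals [a] on the others, [a - l] is constant on the
   deletion. So [a] is constant on each class of the splitting, and it vanishes at the
   representatives. *)
have key u a : u \in W -> a \in supp_on R H -> restrict R (dinterval C U d) u = Phi a -> a = 0.
  move=> uW /mem_supp_on aH eqa.
  have [l [b lb]] := cell_affine c' uW.
  have atX X : dinterval C U d X -> u X = Phi a X.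
    by move=> iX; rewrite -eqa restrictE iX.
  apply/ffunP => x; rewrite ffunE; apply: (Hzero (fun x => a x)) => // x' y xE yE xyF.
  have lxy : l x' = l y.
    apply: (spl l) => //; right => X Y XB YB.
    have uB Z : Z \in con (minimizers (dinterval C U d) (weight w c)) e ->
        \sum_(z in Z) l z = - b.
      rewrite inE => /andP[Zc eZ]; have := lb Z; rewrite -cE => /(_ Zc).
      have /minimizersP[iZ _] := Zc; rewrite (atX _ iZ) PhiE.
      rewrite /dinterval subsetD1 eZ !andbF => /eqP; rewrite eq_sym addr_eq0.
      by move/eqP.
    by rewrite !uB.
  suff : a x' - l x' = a y - l y by rewrite lxy => /addIr.
  apply: (spl (fun z => a z - l z)) => //; left => X Y XA YA.
  have uA Z : Z \in del (minimizers (dinterval C U d) (weight w c)) e ->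
      \sum_(z in Z) (a z - l z) = b.
    rewrite inE => /andP[Zc eZ]; have := lb Z; rewrite -cE => /(_ Zc).
    have /minimizersP[iZ _] := Zc; rewrite (atX _ iZ) PhiE.
    have -> : dinterval C (U :\ e) d Z.
      by move/and3P: iZ => [? ? ?]; apply/and3P; rewrite subsetD1 eZ andbT.
    by rewrite sumrB => ->; rewrite addrC addKr.
  by rewrite !uA.
have dimPhi : \dim (Phi @: supp_on R H) = #|H|.
  rewrite limg_dim_eq ?dim_supp_on //; apply/eqP; rewrite -subv0; apply/subvP => a.
  rewrite memv_cap memv_ker memv0 => /andP[aH /eqP Pa]; apply/eqP.
  by apply: (key 0 a); rewrite ?mem0v // linear0 Pa.
have disj : (minor C U :&: (Phi @: supp_on R H) = 0)%VS.
  apply/eqP; rewrite -subv0; apply/subvP => v; rewrite memv_cap memv0.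
  move=> /andP[/memv_imgP[u uW ->] /memv_imgP[a aH ua]].
  by rewrite ua (key u a) // linear0.
apply: leq_trans (leq_add (leqnn _) cardH) _.
rewrite -dimPhi -(dimv_disjoint_sum disj).
apply: leq_trans (dimvS _) (dimv_add_leqif _ _).
move: (eUC); rewrite inE => /andP[eC eU].
rewrite subv_add; apply/andP; split; apply/subvP => v /memv_imgP[u uW ->].
  have -> : restrict R (dinterval C U d) u =
      restrict R (dinterval C (U :\ e) d) u + restrict R (dinterval (e |: C) U d) u.
    apply/ffunP => X; rewrite [RHS]ffunE !restrictE /dinterval subsetD1 subUset sub1set.
    by case: (e \in X); rewrite ?andbT ?andbF /= ?add0r ?addr0.
  by apply: memv_add; exact: memv_img.
have [u' u'W u'E] := linear_in u.
have -> : Phi u = restrict R (dinterval C (U :\ e) d) u'.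
  apply/ffunP => X; rewrite PhiE restrictE; case: ifP => // /and3P[_ _ /eqP dX].
  by rewrite u'E.
by apply: (subvP (addvSl _ _)); exact: memv_img.
Qed.

Lemma card_dinterval_bottom C U : C \subset U -> d = #|C|.+1 ->
  (#|[set X | dinterval C U d X]| <= #|U :\: C|)%N.
Proof.
move=> CU dC; apply: leq_trans (leq_imset_card (fun x => x |: C) _).
apply/subset_leq_card/subsetP => X; rewrite inE => /and3P[CX XU /eqP dX].
have : #|X :\: C| == 1%N by rewrite cardsDS // dX dC subSnn.
move=> /cards1P[x XC]; apply/imsetP; exists x.
  have : x \in X :\: C by rewrite XC inE.
  by rewrite !inE => /andP[-> /(subsetP XU) ->].
by rewrite -XC setUC -{1}(setID X C) (setIidPr CX).
Qed.

Lemma card_dinterval_top C U : C \subset U -> #|U| = d.+1 ->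
  (#|[set X | dinterval C U d X]| <= #|U :\: C|)%N.
Proof.
move=> CU dU; apply: leq_trans (leq_imset_card (fun x => U :\ x) _).
apply/subset_leq_card/subsetP => X; rewrite inE => /and3P[CX XU /eqP dX].
have : #|U :\: X| == 1%N by rewrite cardsDS // dX dU subSnn.
move=> /cards1P[x XC]; apply/imsetP; exists x.
  have : x \in U :\: X by rewrite XC inE.
  by rewrite !inE => /andP[xX ->]; rewrite andbT; apply: contraNN xX; exact: (subsetP CX).
by rewrite -XC setDDr setDv set0U (setIidPr XU).
Qed.

Lemma pascal_minor p (k c : nat) : (c + 2 <= k)%N -> (3 <= p)%N ->
  'C(p.+1 - 2, k - c - 1) = ('C(p - 2, k - c - 1) + 'C(p - 2, k - c.+1 - 1))%N.
Proof.
move=> ck p3; have [j ->] : exists j, k = (c + j.+2)%N by exists (k - c - 2)%N; lia.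
have [q ->] : exists q, p = q.+2 by exists (p - 2)%N; lia.
have -> : (q.+3 - 2 = q.+1)%N by lia.
have -> : (q.+2 - 2 = q)%N by lia.
have -> : (c + j.+2 - c - 1 = j.+1)%N by lia.
have -> : (c + j.+2 - c.+1 - 1 = j)%N by lia.
exact: binS.
Qed.

(** With [m] elements and rank [r], the strict inequality expresses the bound
    ['C(m - 2, r - 1) + m - 1]. In rank or corank 1 there are at most [m] vertices. Otherwise
    Pascal's rule adds up the binomials, and the remaining terms give
    [2 (m - 2) - (m - 3) = m - 1]. *)
Lemma dim_minor C U : C \subset U -> (#|C| < d < #|U|)%N ->
  (\dim (minor C U) < 'C(#|U :\: C| - 2, d - #|C| - 1) + #|U :\: C|)%N.
Proof.
have [m] := ubnP #|U :\: C|.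
elim: m C U => // m IH C U ltm CU /andP[Cd dU].
have bin_pos : (0 < 'C(#|U :\: C| - 2, d - #|C| - 1))%N.
  by rewrite bin_gt0 cardsDS //; lia.
have [dC|dC] := eqVneq d #|C|.+1.
  apply: leq_ltn_trans (dim_restrict _ _) _.
  apply: leq_ltn_trans (card_dinterval_bottom CU dC) _.
  by rewrite -[X in (X < _)%N]add0n ltn_add2r.
have [Ud|Ud] := eqVneq #|U| d.+1.
  apply: leq_ltn_trans (dim_restrict _ _) _.
  apply: leq_ltn_trans (card_dinterval_top CU Ud) _.
  by rewrite -[X in (X < _)%N]add0n ltn_add2r.
have Cd2 : (#|C| + 2 <= d)%N by rewrite addn2 ltn_neqAle eq_sym dC.
have dU2 : (d + 2 <= #|U|)%N by rewrite addn2 ltn_neqAle eq_sym Ud.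
have [e eUC] : exists e, e \in U :\: C.
  by apply/set0Pn; rewrite -card_gt0 cardsDS //; lia.
move: (eUC); rewrite inE => /andP[eC eU].
have cUC := cardsDS CU.
have UeC : (U :\ e) :\: C = (U :\: C) :\ e by rewrite setDDl setUC -setDDl.
have UeC' : U :\: (e |: C) = (U :\: C) :\ e by rewrite setUC setDDl.
have cE := cardsD1 e (U :\: C); rewrite eUC add1n in cE.
have cUe := cardsD1 e U; rewrite eU add1n in cUe.
have cCe := cardsU1 e C; rewrite eC add1n in cCe.
have ltm' : (#|(U :\: C) :\ e| < m)%N by rewrite -ltnS -cE.
have p3 : (3 <= #|(U :\: C) :\ e|)%N.
  have : (#|C| + 4 <= #|U|)%N.
    by apply: leq_trans dU2; rewrite -[4%N]/(2 + 2)%N addnA leq_add2r.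
  by rewrite -leq_subRL ?subset_leq_card // -cUC cE.
have Cd' : (#|C| < d < #|U :\ e|)%N by rewrite Cd -ltnS -cUe -addn2.
have := IH C (U :\ e); rewrite UeC => /(_ ltm').
rewrite subsetD1 CU eC => /(_ isT Cd') IH1.
have Cd'' : (#|e |: C| < d < #|U|)%N by rewrite cCe dU andbT -addn2.
have := IH (e |: C) U; rewrite UeC' => /(_ ltm').
rewrite subUset sub1set eU CU => /(_ isT Cd''); rewrite cCe => IH2.
have := dim_minor_step CU Cd2 dU2 eUC.
rewrite cE pascal_minor //; move: p3 IH1 IH2.
move: (\dim _) (\dim _) (\dim _) (binomial _ _) (binomial _ _) => D0 D1 D2 b1 b2.
move: #|_ :\ e| => p; clear; lia.
Qed.

End UpperBound.

(** * Regular subdivisions of the hypersimplex *)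

Section ConvexHull.
Variables (R : realType).

Lemma conv_hull_vertex m (I : finType) (A : {set I}) (a : I -> 'rV[R]_m) i :
  i \in A -> conv_hull A a (a i).
Proof.
move=> iA; exists (fun j => (j == i)%:R); split=> //.
- by rewrite (bigD1 i) //= eqxx big1 ?addr0 // => j /andP[_ /negPf ->].
- rewrite (bigD1 i) //= eqxx scale1r big1 ?addr0 // => j /andP[_ /negPf ->].
  by rewrite scale0r.
Qed.

Lemma dot_sum m (I : finType) (A : {set I}) (a : I -> 'rV[R]_m) (l : I -> R) c :
  dot c (\sum_(i in A) l i *: a i) = \sum_(i in A) l i * dot c (a i).
Proof.
rewrite /dot; under eq_bigr do rewrite summxE mulr_sumr.
rewrite exchange_big; apply: eq_bigr => i _; rewrite mulr_sumr.
by apply: eq_bigr => j _; rewrite mxE mulrCA.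
Qed.

(** A convex combination attains the minimum only if every point of nonzero weight does, since the
    weighted excesses are nonnegative. *)
Lemma conv_hull_face m (I : finType) (a : I -> 'rV[R]_m) c p :
  (conv_hull [set: I] a p /\ forall q, conv_hull [set: I] a q -> dot c p <= dot c q) <->
  conv_hull [set i | [forall j, dot c (a i) <= dot c (a j)]] a p.
Proof.
set A := [set i | _]; split.
  move=> [[l [l0 l1 pE]] pmin].
  have [i0 _] : exists2 i : I, i \in [set: I] & l i != 0.
    apply/exists_inP; apply: contraT => /exists_inPn l_eq0.
    move: l1; rewrite big1 => [/esym/eqP|i /l_eq0]; first by rewrite oner_eq0.
    by rewrite negbK => /eqP.
  move=> _; case: (@arg_minP _ _ _ i0 xpredT (fun i => dot c (a i)) isT) => i1 _ i1min.
  have le_p := pmin _ (conv_hull_vertex a (in_setT i1)).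
  have zero i : l i * (dot c (a i) - dot c (a i1)) = 0.
    have ge0 j : true -> 0 <= l j * (dot c (a j) - dot c (a i1)).
      by move=> _; rewrite mulr_ge0 ?l0 // subr_ge0 i1min.
    apply: (psumr_eq0P ge0) => //; apply/eqP; rewrite eq_le sumr_ge0 // andbT.
    under eq_bigr do rewrite mulrBr; rewrite sumrB -mulr_suml.
    move: l1 le_p; rewrite pE dot_sum.
    rewrite (eq_bigl xpredT) => [->|j]; last by rewrite inE.
    rewrite (eq_bigl xpredT) => [le_p|j]; last by rewrite inE.
    by rewrite mul1r subr_le0.
  have lA i : i \notin A -> l i = 0.
    move=> iA; have /eqP := zero i; rewrite mulf_eq0 subr_eq0 => /orP[/eqP //|/eqP ci].
    by move: iA; rewrite inE ci => /forallP[] j; exact: i1min.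
  have big_A (V : nmodType) (f : I -> V) : (forall i, i \notin A -> f i = 0) ->
      \sum_(i in A) f i = \sum_(i in [set: I]) f i.
    move=> f0; rewrite big_mkcond [RHS]big_mkcond; apply: eq_bigr => i _.
    by rewrite [i \in [set: I]]inE; case: ifPn => // /f0.
  exists l; split; first by move=> i _; apply: l0; rewrite inE.
    by rewrite big_A.
  by rewrite big_A // => i /lA ->; rewrite scale0r.
move=> [l [l0 l1 ->]].
have minA i j : i \in A -> dot c (a i) <= dot c (a j) by rewrite inE => /forallP.
have [i0 i0A] : exists i, i \in A.
  apply/set0Pn; apply: contra_eqN l1 => /eqP ->; rewrite big_set0.
  by rewrite eq_sym oner_eq0.
have dE : \sum_(i in A) l i * dot c (a i) = dot c (a i0).
  rewrite -[RHS]mul1r -l1 mulr_suml; apply: eq_bigr => i iA.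
  by congr (_ * _); apply/eqP; rewrite eq_le !minA.
split.
  exists (fun i => if i \in A then l i else 0); split.
  - by move=> i _; case: ifP => // /l0.
  - by rewrite -l1 [RHS]big_mkcond; apply: eq_bigl => i; rewrite inE.
  - rewrite big_mkcond [RHS]big_mkcond; apply: eq_bigr => i _.
    by rewrite [i \in [set: I]]inE; case: ifP => // _; rewrite scale0r.
move=> q [k [k0 k1 ->]]; rewrite !dot_sum dE -[X in X <= _]mul1r -k1 mulr_suml.
by apply: ler_sum => i iT; rewrite ler_wpM2l ?k0 // minA.
Qed.

Lemma conv_hull_lsubmx m k (I : finType) (A : {set I}) (a : I -> 'rV[R]_m)
    (b : I -> 'rV[R]_k) :
  classical_sets.image (conv_hull A (fun i => row_mx (a i) (b i))) lsubmx =
  conv_hull A a.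
Proof.
have sum_row l : \sum_(i in A) l i *: row_mx (a i) (b i) =
    row_mx (\sum_(i in A) l i *: a i) (\sum_(i in A) l i *: b i).
  apply/rowP => j; rewrite summxE mxE; case: splitP => s js; rewrite summxE;
    apply: eq_bigr => i _; rewrite !mxE.
    by have -> : j = lshift k s; [exact: val_inj | rewrite (unsplitK (inl s))].
  by have -> : j = rshift m s; [exact: val_inj | rewrite (unsplitK (inr s))].
apply/funext => p; apply/propext; split.
  by move=> [_ [l [l0 l1 ->]] <-]; exists l; rewrite sum_row row_mxKl.
move=> [l [l0 l1 ->]].
exists (\sum_(i in A) l i *: row_mx (a i) (b i)); first by exists l.
by rewrite sum_row row_mxKl.
Qed.

Variable n : nat.
Implicit Types (M : {set {set 'I_n}}).

(** Coordinates 0 and 1 are extremal in the unit interval, so a set of nonzero weight agrees with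
    [X] in every coordinate. *)
Lemma char_vec_conv_hull M X : conv_hull M (@char_vec R n) (char_vec R X) -> X \in M.
Proof.
move=> [l [l0 l1 XE]].
have [Y YM lY] : exists2 Y : {set 'I_n}, Y \in M & l Y != 0.
  apply/exists_inP; apply: contraT => /exists_inPn l_eq0.
  move: l1; rewrite big1 => [/esym/eqP|i /l_eq0]; first by rewrite oner_eq0.
  by rewrite negbK => /eqP.
suff -> : X = Y by [].
have coord x : (x \in X)%:R = \sum_(Z in M) l Z * (x \in Z)%:R :> R.
  have := congr1 (fun v : 'rV[R]_n => v 0 x) XE; rewrite summxE mxE => ->.
  by apply: eq_bigr => Z _; rewrite !mxE.
apply/setP => x; have [xX|xX] := boolP (x \in X).
  have : l Y * (1 - (x \in Y)%:R) = 0.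
    apply: (psumr_eq0P (P := mem M) (F := fun Z => l Z * (1 - (x \in Z)%:R))) => //.
      by move=> Z /l0 lZ; rewrite mulr_ge0 // subr_ge0; case: (x \in Z); rewrite ?ler01.
    under eq_bigr do rewrite mulrBr mulr1; rewrite sumrB -coord l1 xX subrr //.
  move/eqP; rewrite mulf_eq0 (negPf lY) subr_eq0 /=.
  by case: (x \in Y) => //; rewrite oner_eq0.
have : l Y * (x \in Y)%:R = 0.
  apply: (psumr_eq0P (P := mem M) (F := fun Z => l Z * (x \in Z)%:R)) => //.
    by move=> Z /l0 lZ; rewrite mulr_ge0.
  by rewrite -coord (negPf xX).
move/eqP; rewrite mulf_eq0 (negPf lY) /=.
by case: (x \in Y) => //; rewrite oner_eq0.
Qed.

Lemma conv_hull_char_vec_inj M M' :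
  conv_hull M (@char_vec R n) = conv_hull M' (@char_vec R n) -> M = M'.
Proof.
move=> E; apply/setP => X; apply/idP/idP => XM; apply: char_vec_conv_hull.
  by rewrite -E; exact: conv_hull_vertex.
by rewrite E; exact: conv_hull_vertex.
Qed.

End ConvexHull.

(** * Cells of the hypersimplex as families of minimizers *)

Section Hypersimplex.
Variables (R : realType) (d n : nat).
Local Notation J := (dsubset d n).
Local Notation lifting := {ffun J -> R^o}.
Implicit Types (w : lifting) (c : 'I_n -> R) (X : {set 'I_n}).

(** Cells are families in the type of all subsets. The default 0 is never seen by them, because
    [hyper_cell] compares [d]-subsets only. *)
Definition extend w X : R := if insub X is Some j then w j else 0.

Lemma extend_val w (j : J) : extend w (val j) = w j.
Proof. by rewrite /extend valK. Qed.

Definition extend_ffun w : {ffun {set 'I_n} -> R^o} := [ffun X => extend w X].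

Lemma extend_ffun_linear : linear extend_ffun.
Proof.
move=> k u v; apply/ffunP => X; rewrite !ffunE /extend.
by case: insub => [j|]; rewrite ?ffunE // scaler0 addr0.
Qed.

HB.instance Definition _ := GRing.isLinear.Build R lifting {ffun {set 'I_n} -> R^o} _
  extend_ffun extend_ffun_linear.

Definition hyper_cell w c :=
  minimizers (dinterval finset.set0 [set: 'I_n] d) (weight (extend w) c).

Lemma dinterval_full X : dinterval finset.set0 [set: 'I_n] d X = (#|X| == d).
Proof. by rewrite /dinterval sub0set subsetT. Qed.

Lemma dot_char_vec (c : 'rV[R]_n) X : dot c (char_vec R X) = \sum_(x in X) c 0 x.
Proof.
rewrite /dot [RHS]big_mkcond; apply: eq_bigr => x _.
by rewrite mxE; case: (x \in X); rewrite ?mulr1 ?mulr0.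
Qed.

Lemma conv_hull_val (A : {set J}) :
  conv_hull A (@hypersimplex_vertex R d n) = conv_hull [set val j | j in A] (@char_vec R n).
Proof.
have big_val (V : nmodType) (f : {set 'I_n} -> V) :
    \sum_(X in [set val j | j in A]) f X = \sum_(j in A) f (val j).
  by rewrite big_imset //; move=> i j _ _; exact: val_inj.
apply/funext => p; apply/propext; split=> -[l [l0 l1 ->]].
  exists (fun X => if insub X is Some j then l j else 0); split.
  - by move=> _ /imsetP[j jA ->]; rewrite valK l0.
  - by rewrite big_val -l1; apply: eq_bigr => j _; rewrite valK.
  - by rewrite big_val; apply: eq_bigr => j _; rewrite valK.
exists (fun j => l (val j)); split.
- by move=> j jA; apply: l0; exact: imset_f.
- by rewrite -big_val.
- by rewrite big_val.
Qed.

(** Dividing a lower functional by its positive last coordinate leaves its face unchanged and turns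
    its values into tilted heights. *)
Lemma regular_subdivisionP w P : regular_subdivision (@hypersimplex_vertex R d n) w P <->
  exists c, P = conv_hull (hyper_cell w c) (@char_vec R n).
Proof.
have dotE (c : 'rV[R]_(n + 1)) (j : J) : 
    dot c (row_mx (hypersimplex_vertex R j) (w j)%:M) =
    \sum_(x in val j) c 0 (lshift 1 x) + c 0 (rshift n ord0) * w j.
  rewrite /dot big_split_ord /= big_ord1 row_mxEr mxE eqxx mulr1n; congr (_ + _).
  rewrite [RHS]big_mkcond; apply: eq_bigr => x _; rewrite row_mxEl mxE.
  by case: (x \in val j); rewrite ?mulr1 ?mulr0.
have cellE (c : 'rV[R]_(n + 1)) (c' : 'I_n -> R) : 0 < c 0 (rshift n ord0) ->
    (forall x, c' x = c 0 (lshift 1 x) / c 0 (rshift n ord0)) ->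
    conv_hull [set i : J | [forall j, dot c (row_mx (hypersimplex_vertex R i) (w i)%:M) <=
                                      dot c (row_mx (hypersimplex_vertex R j) (w j)%:M)]]
      (@hypersimplex_vertex R d n) = conv_hull (hyper_cell w c') (@char_vec R n).
  move=> c0 c'E; rewrite conv_hull_val; congr conv_hull.
  have wE j : dot c (row_mx (hypersimplex_vertex R j) (w j)%:M) =
      c 0 (rshift n ord0) * weight (extend w) c' (val j).
    rewrite dotE /weight extend_val mulrDr addrC; congr (_ + _).
    by rewrite mulr_sumr; apply: eq_bigr => x _; rewrite c'E mulrC divfK ?gt_eqF.
  apply/setP => X; apply/imsetP/minimizersP.
    move=> [i]; rewrite inE => /forallP imin ->; split.
      by rewrite dinterval_full (valP i).
    move=> Y; rewrite dinterval_full => dY.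
    by have := imin (Sub Y dY); rewrite !wE ler_pM2l.
  rewrite dinterval_full => -[dX minX]; exists (Sub X dX) => //.
  rewrite inE; apply/forallP => j; rewrite !wE ler_pM2l //; apply: minX.
  by rewrite dinterval_full (valP j).
have faceE (c : 'rV[R]_(n + 1)) :
    classical_sets.mkset (fun p => lifted_polytope (@hypersimplex_vertex R d n) w p /\
      forall q, lifted_polytope (@hypersimplex_vertex R d n) w q -> dot c p <= dot c q)
    = conv_hull [set i : J | [forall j, dot c (row_mx (hypersimplex_vertex R i) (w i)%:M) <=
                                      dot c (row_mx (hypersimplex_vertex R j) (w j)%:M)]]
      (fun i => row_mx (hypersimplex_vertex R i) (w i)%:M).
  by apply/funext => p; apply/propext; exact: conv_hull_face.
split.
  move=> [_ [c c0 ->] <-]; rewrite faceE conv_hull_lsubmx.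
  by eexists; exact: (cellE c _ c0 (fun x => erefl)).
move=> [c ->]; pose c1 : 'rV[R]_(n + 1) := row_mx (\row_x c x) 1%:M.
have c1r : c1 0 (rshift n ord0) = 1 by rewrite row_mxEr mxE eqxx.
eexists; first by exists c1; rewrite ?c1r ?ltr01.
rewrite faceE conv_hull_lsubmx; apply: cellE; first by rewrite c1r.
by move=> x; rewrite c1r divr1 row_mxEl mxE.
Qed.

Hypothesis dn : (d <= n)%N.

Lemma hyper_cell_neq0 w c : hyper_cell w c != finset.set0.
Proof.
have [X iX] : exists X, dinterval finset.set0 [set: 'I_n] d X.
  by apply: dinterval_ex; rewrite ?sub0set // cards0 cardsT card_ord.
by have [Y Yc] := minimizers_ex (weight (extend w) c) iX; apply/set0Pn; exists Y.
Qed.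

Lemma tropical_pluckerP w :
  tropical_plucker w <-> forall c, exchange (hyper_cell w c).
Proof.
split=> [tp c|ex P /regular_subdivisionP[c ->]].
  have /tp[BB [_ exBB]] : regular_subdivision (@hypersimplex_vertex R d n) w
      (conv_hull (hyper_cell w c) (@char_vec R n)).
    by apply/regular_subdivisionP; exists c.
  by move=> /conv_hull_char_vec_inj ->; exact: exBB.
by exists (hyper_cell w c) => //; split; [exact: hyper_cell_neq0 | exact: ex].
Qed.

Lemma same_subdivision_cell w w' c :
  regular_subdivision (@hypersimplex_vertex R d n) w' =
  regular_subdivision (@hypersimplex_vertex R d n) w ->
  exists c', hyper_cell w c = hyper_cell w' c'.
Proof.
move=> E; have : regular_subdivision (@hypersimplex_vertex R d n) w
    (conv_hull (hyper_cell w c) (@char_vec R n)).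
  by apply/regular_subdivisionP; exists c.
by rewrite -E => /regular_subdivisionP[c' /conv_hull_char_vec_inj]; exists c'.
Qed.

End Hypersimplex.

(** * The dimension of the Dressian *)

Section Bounds.
Variables (R : realType) (d n : nat).
Hypotheses (d_gt0 : (0 < d)%N) (d_ltn : (d < n)%N).
Local Notation J := (dsubset d n).
Local Notation lifting := {ffun J -> R^o}.
Local Notation vert := (@hypersimplex_vertex R d n).
Local Notation L := (lineality vert).
Implicit Types (w u v : lifting) (c : 'I_n -> R) (X Y : {set 'I_n}).

Let dn : (d <= n)%N := ltnW d_ltn.

Let mk X (dX : #|X| == d) : J := exist _ X dX.

Lemma dsubset_ex x y : x != y -> exists j : J, (x \in val j) && (y \notin val j).
Proof.
move=> xy; have [||X /and3P[xX Xy dX]] := @dinterval_ex 'I_n [set x] (~: [set y]) d.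
- by rewrite sub1set !inE.
- rewrite cards1 d_gt0 -ltnS; have := cardsC [set y].
  by rewrite cards1 card_ord add1n => ->.
exists (mk dX); rewrite sub1set in xX; rewrite xX /=.
by apply/negP => /(subsetP Xy); rewrite !inE eqxx.
Qed.

Lemma sum_const_const (g : 'I_n -> R) k :
  (forall j : J, \sum_(x in val j) g x = k) -> forall x y, g x = g y.
Proof.
move=> gk x y; have [->//|xy] := eqVneq x y.
have [j /andP[xj yj]] := dsubset_ex xy.
have dj : #|swap (val j) x y| == d by rewrite card_swap // (eqP (valP j)).
have := big_swap g xj yj; rewrite gk.
have /= -> := gk (mk dj).
by move/addrI.
Qed.

Lemma linear_lineality (a : 'I_n -> R) (b : R) :
  [ffun j : J => \sum_(x in val j) a x + b] \in L.
Proof.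
apply/mem_lineality; exists (\row_x a x), b => j.
rewrite ffunE dot_char_vec; congr (_ + _).
by apply: eq_bigr => x _; rewrite mxE.
Qed.

Lemma linealityP v : v \in L ->
  exists (a : 'I_n -> R) (b : R), forall j, v j = \sum_(x in val j) a x + b.
Proof.
move=> /mem_lineality[a [b vE]]; exists (fun x => a 0 x), b => j.
by rewrite vE dot_char_vec.
Qed.

Definition linear_lift (a : {ffun 'I_n -> R^o}) : lifting :=
  [ffun j : J => \sum_(x in val j) a x].

Lemma linear_lift_linear : linear linear_lift.
Proof.
move=> k a b; apply/ffunP => j; rewrite !ffunE scaler_sumr -big_split.
by apply: eq_bigr => x _; rewrite !ffunE.
Qed.

HB.instance Definition _ := GRing.isLinear.Build R {ffun 'I_n -> R^o} lifting _
  linear_lift linear_lift_linear.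

(** A linear functional that vanishes on all [d]-subsets has equal coefficients, by swaps; they are
    0 since [d] is positive. *)
Lemma dim_lineality : (n <= \dim L)%N.
Proof.
have dimE : \dim (linfun linear_lift @: fullv) = n.
  rewrite limg_dim_eq ?dim_ffun ?card_ord // capfv.
  apply/eqP; rewrite -subv0; apply/subvP => a; rewrite memv_ker memv0 lfunE /=.
  move=> /eqP a0; have sum0 (j : J) : \sum_(x in val j) a x = 0.
    by have := congr1 (fun u : lifting => u j) a0; rewrite !ffunE.
  have const := sum_const_const sum0.
  apply/eqP/ffunP => x; rewrite ffunE.
  have n1 : (1 < n)%N by exact: leq_ltn_trans d_gt0 d_ltn.
  have [y xy] : exists y : 'I_n, y != x.
    apply/existsP; apply: contraT => /existsPn sub1.
    have := card_ord n; rewrite (@eq_card1 _ x) => [n1E|y]; first by rewrite -n1E in n1.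
    by apply/esym; have := sub1 y; rewrite negbK inE.
  have [j _] := dsubset_ex xy; move: (sum0 j).
  rewrite (eq_bigr (fun=> a x)) => [|z _]; last exact: const.
  rewrite sumr_const (eqP (valP j)) => /eqP; rewrite mulrn_eq0.
  by rewrite eqn0Ngt d_gt0 => /eqP.
rewrite -[X in (X <= _)%N]dimE; apply/dimvS/subvP => v /memv_imgP[a _ ->]; rewrite lfunE /=.
have -> : linear_lift a = [ffun j : J => \sum_(x in val j) a x + 0].
  by apply/ffunP => j; rewrite !ffunE addr0.
exact: linear_lineality.
Qed.

Let Ext : 'Hom(lifting, {ffun {set 'I_n} -> R^o}) := linfun (@extend_ffun R d n).

Let ExtE w X : Ext w X = extend w X.
Proof. by rewrite lfunE /= ffunE. Qed.

(** Each lifting in the cone has the given cell of [w] among its own cells, so it agrees there with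
    an affine function. The liftings with this property form the subspace
    [L + supp_on R offcell]. *)
Lemma secondary_cone_affine w c u : u \in (lin_span (secondary_cone vert w) + L)%VS ->
  exists (a : 'I_n -> R) (b : R),
    forall X, X \in hyper_cell w c -> extend u X = \sum_(x in X) a x + b.
Proof.
pose offcell : {set J} := [set j | val j \notin hyper_cell w c].
have sub : (lin_span (secondary_cone vert w) + L <= L + supp_on R offcell)%VS.
  rewrite subv_add addvSl andbT; apply: (proj2 (lin_spanP _)) => w' w'C.
  have [c' cE] := same_subdivision_cell c w'C.
  have [X0 X0c] := set0Pn _ (hyper_cell_neq0 dn w c).
  pose m := weight (extend w') c' X0.
  have cellE X : X \in hyper_cell w c -> extend w' X = \sum_(x in X) - c' x + m.
    move: X0c; rewrite cE => /minimizersP[PX0 minX0] /minimizersP[PX minX].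
    have : weight (extend w') c' X = m by apply/eqP; rewrite eq_le minX // minX0.
    by rewrite /weight sumrN => <-; rewrite addrC addrK.
  pose f : lifting := [ffun j : J => \sum_(x in val j) - c' x + m].
  rewrite -(subrK f w') addrC; apply: memv_add; first exact: linear_lineality.
  apply/mem_supp_on => j; rewrite inE negbK => jc; rewrite !ffunE.
  by rewrite -(cellE _ jc) extend_val subrr.
move=> /(subvP sub)/memv_addP[f /linealityP[a [b fE]] [v vs ->]].
exists a, b => X Xc; have /minimizersP[+ _] := Xc.
rewrite dinterval_full => dX.
have -> : X = val (mk dX) by [].
rewrite extend_val ffunE fE.
have -> : v (mk dX) = 0.
  by move/mem_supp_on: vs => -> //; rewrite inE /= Xc.
by rewrite addr0.
Qed.

(** This is [dim_minor] for the whole hypersimplex; the summand [n] of its bound is absorbed by the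
    lineality space. *)
Lemma Dressian_cone_leq (C : lifting -> Prop) : Dressian C ->
  (cone_dim_mod L C < 'C(n - 2, d - 1))%N.
Proof.
move=> [[w _ <-] tp].
have tpw : tropical_plucker w by apply: tp.
pose W' := (lin_span (secondary_cone vert w) + L)%VS; pose W := (Ext @: W')%VS.
have Waff c (f : {ffun {set 'I_n} -> R^o}) : f \in W -> exists (l : 'I_n -> R) (b : R),
    forall X, X \in hyper_cell w c -> f X = \sum_(x in X) l x + b.
  move=> /memv_imgP[u' u'W ->].
  have [a [b uE]] := secondary_cone_affine c u'W.
  by exists a, b => X Xc; rewrite ExtE uE.
have Wlin (a : 'I_n -> R) :
    exists2 f : {ffun {set 'I_n} -> R^o}, f \in W &
      forall X, #|X| = d -> f X = \sum_(x in X) a x.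
  exists (Ext [ffun j : J => \sum_(x in val j) a x + 0]).
    by apply/memv_img/(subvP (addvSr _ _))/linear_lineality.
  move=> X /eqP dX; rewrite ExtE.
  have -> : X = val (mk dX) by [].
  by rewrite extend_val ffunE addr0.
have := dim_minor (proj1 (tropical_pluckerP dn w) tpw) Waff Wlin (sub0set setT).
rewrite cards0 cardsT card_ord setD0 cardsT card_ord subn0 => /(_ _) bound.
have {}bound := bound _; rewrite d_gt0 d_ltn in bound; have {bound} := bound isT.
(* Extending a lifting and restricting it to the [d]-subsets is injective, so the dimension is that
   of [W']. *)
rewrite -limg_comp limg_dim_eq => [ltW|].
  rewrite /cone_dim_mod -/W' ltn_subLR; last by apply/dimvS/addvSr.
  by apply: leq_trans ltW _; rewrite addnC leq_add2r dim_lineality.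
apply/eqP; rewrite -subv0; apply/subvP => u; rewrite memv_cap memv_ker memv0.
move=> /andP[_ /eqP u0]; apply/eqP/ffunP => j; rewrite ffunE.
have := congr1 (fun f : {ffun {set 'I_n} -> R^o} => f (val j)) u0.
rewrite comp_lfunE restrictE dinterval_full (valP j) ExtE extend_val.
by move=> ->; rewrite ffunE.
Qed.

(** * Liftings supported on stable sets of the Johnson graph *)

Definition stable (S : {set J}) := forall (i j : J) x y, i \in S ->
  x \in val i -> y \notin val i -> val j = swap (val i) x y -> j \notin S.

Lemma card_dsubset : #|{: J}| = 'C(n, d).
Proof. by rewrite card_sig -[in RHS](card_ord n) -card_draws cardsE. Qed.

Lemma stable_ex : exists2 S, stable S & ('C(n, d) <= n * #|S|)%N.
Proof.
have n0 : (0 < n)%N by exact: leq_ltn_trans (leq0n d) d_ltn.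
pose f (j : J) : 'I_n := Ordinal (ltn_pmod (\sum_(x in val j) x) n0).
pose S r := [set j | f j == r].
have st r : stable (S r).
  move=> i j x y; rewrite !inE => /eqP <- xi yi jE.
  apply: contraNN (yi) => /eqP /(congr1 val) /= fE; suff -> : y = x by [].
  have sE : (\sum_(z in swap (val i) x y) z + x = \sum_(z in val i) z + y)%N.
    exact: (@big_swap _ nat (fun z : 'I_n => z : nat)).
  have /eqP : ((\sum_(z in val i) z + y) %% n = (\sum_(z in val i) z + x) %% n)%N.
    by rewrite -sE -jE -modnDml fE modnDml.
  by rewrite eqn_modDl !modn_small // => /eqP /val_inj.
suff [r le] : exists r, ('C(n, d) <= n * #|S r|)%N by exists (S r).
apply/existsP; apply: contraT => /existsPn lt.
have sumE : \sum_(r < n) #|S r| = 'C(n, d).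
  rewrite -card_dsubset -[RHS]sum1_card (partition_big f xpredT) //=.
  by apply: eq_bigr => r _; rewrite -sum1_card; apply: eq_bigl => j; rewrite inE.
have : (\sum_(r < n) (n * #|S r|).+1 <= \sum_(r < n) 'C(n, d))%N.
  by apply: leq_sum => r _; rewrite ltnNge; exact: lt.
under eq_bigr do rewrite -addn1.
rewrite big_split /= -big_distrr /= sumE !sum_nat_const card_ord muln1.
by rewrite -[X in (_ <= X)%N]addn0 leq_add2l leqNgt n0.
Qed.

Section StableLifting.
Variables (S : {set J}) (w : lifting).
Hypotheses (S_stable : stable S) (w_ge0 : forall j, 0 <= w j).
Hypothesis w_supp : forall j, j \notin S -> w j = 0.

Let bad X := [exists j in S, val j == X].

Let bad_swap X x y : bad X -> x \in X -> y \notin X -> ~~ bad (swap X x y).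
Proof.
move=> /exists_inP[i iS /eqP <-] xi yi; apply/exists_inP => -[j jS /eqP jE].
by move: jS; apply/negP; exact: S_stable iS xi yi jE.
Qed.

Let extend_bad X : ~~ bad X -> extend w X = 0.
Proof.
rewrite /extend; case: insubP => // j _ <- jS; apply: w_supp.
by apply: contraNN jS => jS; apply/exists_inP; exists j.
Qed.

Let extend_ge0 X : 0 <= extend w X.
Proof. by rewrite /extend; case: insubP => // j _ _. Qed.

Let swap_swap X x y y' : y \notin X -> y' \notin X -> x \in X ->
  swap X x y' = swap (swap X x y) y y'.
Proof.
move=> yX y'X xX; apply/setP => z; rewrite !inE.
by case: (eqVneq z y) => [->|//]; rewrite (negPf yX) !andbF.
Qed.

Let swap_swap' X x y y' : x \notin X -> y \in X -> y' \in X -> y != y' ->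
  swap X y' x = swap (swap X y x) y' y.
Proof.
move=> xX yX y'X yy'; apply/setP => z; rewrite !inE.
case: (eqVneq z y) => [->|zy] /=; first by rewrite yy' yX orbT.
case: (eqVneq z x) => [->|//] /=; rewrite andbT; apply/esym.
by apply: contraNneq xX => ->.
Qed.

(** Two bad sets [swap X x y] for different [y] would be adjacent in the Johnson graph, against
    stability, and likewise for [swap Y y x]. So at most two elements of [Y :\: X] fail, one on each
    side. If these two are all of [Y :\: X], the two bad sets are adjacent to each other. If
    [Y :\: X] is a singleton, the swap gives [Y]. *)
Lemma stable_swap X Y x : #|X| = #|Y| -> x \in X :\: Y ->
  exists2 y, y \in Y :\: X & swap X x y = Y \/
    (~~ bad (swap X x y) /\ ~~ bad (swap Y y x)).
Proof.
move=> cXY xXY; have := xXY; rewrite inE => /andP[xY xX].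
have cD : #|Y :\: X| = #|X :\: Y|.
  by apply/eqP; rewrite -(eqn_add2l #|X :&: Y|) cardsID setIC cardsID cXY.
pose good y := ~~ bad (swap X x y) && ~~ bad (swap Y y x).
have [/exists_inP[y yD /andP[? ?]]|/exists_inPn nogood] := boolP [exists y in Y :\: X, good y].
  by exists y => //; right.
have DE y : y \in Y :\: X -> (y \notin X) /\ (y \in Y) by rewrite inE => /andP[].
have [y1 y1D] : exists y, y \in Y :\: X.
  by apply/set0Pn; rewrite -card_gt0 cD (cardsD1 x) xXY.
have [y2|only] := pickP [pred y in Y :\: X | y != y1]; last first.
  exists y1 => //; left; apply: card_setD_eq.
    by have [y1X _] := DE _ y1D; rewrite card_swap.
  have := card_swapD xXY y1D; rewrite -cD.
  have -> : Y :\: X = [set y1].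
    apply/setP => y; rewrite [RHS]inE; have := only y; rewrite inE.
    by case: eqVneq => [->|_]; rewrite ?y1D // andbT.
  by rewrite cards1 ltnS leqn0 cards_eq0 => /eqP.
rewrite inE => /andP[y2D y21].
have badE y : y \in Y :\: X -> bad (swap X x y) || bad (swap Y y x).
  by move=> yD; have := nogood y yD; rewrite /good negb_and !negbK.
have bad1 y y' : y \in Y :\: X -> y' \in Y :\: X -> y != y' ->
    bad (swap X x y) -> ~~ bad (swap X x y').
  move=> /DE[yX _] /DE[y'X _] yy' b; rewrite (swap_swap yX y'X xX).
  apply: bad_swap => //; first by rewrite !inE eqxx.
  by rewrite !inE (negPf y'X) andbF orbF eq_sym.
have bad2 y y' : y \in Y :\: X -> y' \in Y :\: X -> y != y' ->
    bad (swap Y y x) -> ~~ bad (swap Y y' x).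
  move=> /DE[_ yY] /DE[_ y'Y] yy' b; rewrite (swap_swap' xY yY y'Y yy').
  apply: bad_swap => //; first by rewrite !inE [y' == y]eq_sym yy' y'Y orbT.
  by rewrite !inE eqxx /= orbF; apply: contraNneq xY => <-.
suff contra y y' : y \in Y :\: X -> y' \in Y :\: X -> y != y' ->
    bad (swap X x y) -> bad (swap Y y' x) -> False.
  have [b1|nb1] := boolP (bad (swap X x y1)).
    have := badE y2 y2D; rewrite (negPf (bad1 _ _ y1D y2D _ b1)) 1?eq_sym //= => b2.
    by case: (contra y1 y2 y1D y2D) => //; rewrite eq_sym.
  have := badE y1 y1D; rewrite (negPf nb1) /= => b2.
  have := badE y2 y2D; rewrite (negPf (bad2 _ _ y1D y2D _ b2)) 1?eq_sym // orbF => b1.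
  by case: (contra y2 y1 y2D y1D).
move=> yD y'D yy' b1 b2.
have [y3|only] := pickP [pred z in Y :\: X | (z != y) && (z != y')].
  rewrite inE => /and3P[y3D y3y y3y']; have := badE y3 y3D.
  by rewrite (negPf (bad1 _ _ yD y3D _ b1)) 1?eq_sym //
    (negPf (bad2 _ _ y'D y3D _ b2)) 1?eq_sym.
have DY z : z \in Y -> z \notin X -> (z == y) || (z == y').
  move=> zY zX; have := only z; rewrite inE in_setD zX zY /=.
  by case: (z == y); case: (z == y').
have [[yX yY] [y'X y'Y]] := (DE _ yD, DE _ y'D).
have c2 : #|Y :\: X| = 2%N.
  suff -> : Y :\: X = [set y; y'] by rewrite cards2 yy'.
  apply/setP => z; rewrite !inE; apply/idP/idP => [/andP[zX zY]|]; first exact: DY.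
  by case/orP => /eqP ->; rewrite ?yX ?y'X ?yY ?y'Y.
have [x' x'D] : exists x', x' \in (X :\: Y) :\ x.
  apply/set0Pn; rewrite -card_gt0; have := cardsD1 x (X :\: Y).
  by rewrite -cD c2 xXY add1n => -[<-].
have DX z : z \in X -> z \notin Y -> (z == x) || (z == x').
  move=> zX zY; apply: contraT; rewrite negb_or => /andP[zx zx'].
  have := cardsD1 x (X :\: Y); have := cardsD1 x' ((X :\: Y) :\ x).
  have := cardsD1 z ((X :\: Y) :\ x :\ x'); rewrite -cD c2 xXY x'D.
  by rewrite !in_setD1 zx zx' in_setD zX zY => -> ->.
move: x'D; rewrite !inE => /and3P[x'x x'Y x'X].
(* As [X :\: Y] consists of [x] and [x'], the two bad sets differ by one swap. *)
suff E : swap Y y' x = swap (swap X x y) x' x.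
  move: b2; rewrite E; apply/negP; apply: bad_swap;
    rewrite // !inE ?eqxx ?x'x ?x'X ?orbT //= orbF.
  by apply: contraNneq yX => <-.
apply/setP => z; rewrite !inE.
case: (eqVneq z x) => [//|zx] /=; case: (eqVneq z y) => [->|zy] /=.
  by rewrite yy' yY; case: eqVneq => // yx'; rewrite yx' x'X in yX.
case: (eqVneq z x') => [->|zx'] /=; first by rewrite (negPf x'Y) andbF.
have [zX|zX] := boolP (z \in X).
  case: (eqVneq z y') => [zy'|_] /=; first by rewrite -zy' zX in y'X.
  by apply: contraT => /DX; rewrite (negPf zx) (negPf zx') => /(_ zX).
apply/negP => /andP[zy' zY]; have := DY z zY zX.
by rewrite (negPf zy) (negPf zy').
Qed.

(** The two swapped sets have height 0, and together they have the same linear part as [X] and [Y],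
    whose heights are nonnegative. So their total weight is at most that of two minimizers. *)
Lemma stable_tropical_plucker : tropical_plucker w.
Proof.
apply/(tropical_pluckerP dn) => c X Y x XM YM xXY.
have /minimizersP[dX minX] := XM; have /minimizersP[dY minY] := YM.
move: (dX) (dY); rewrite !dinterval_full => /eqP cX /eqP cY.
have cXY : #|X| = #|Y| by rewrite cX cY.
have [y yYX [XY|[bX bY]]] := stable_swap cXY xXY; first by exists y; rewrite ?XY.
exists y => //.
have /setDP[xX xY] := xXY; have /setDP[yY yX] := yYX.
have dX' : dinterval finset.set0 setT d (swap X x y).
  by rewrite dinterval_full card_swap // cX.
have dY' : dinterval finset.set0 setT d (swap Y y x).
  by rewrite dinterval_full card_swap // cY.
apply/minimizersP; split=> // Z /minX; apply: le_trans.
have := minY _ dY'; rewrite /weight (extend_bad bX) (extend_bad bY).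
have := big_swap c xX yX; have := big_swap c yY xY.
by have := extend_ge0 X; have := extend_ge0 Y; lra.
Qed.

End StableLifting.

(** Evaluation at [j0] is injective. The neighbours of [j0] lie off [S], so if the value at [j0] is
    0, swaps show that all coefficients agree; then the function is constant, hence 0. *)
Lemma dim_stable_lineality S : stable S -> (\dim (supp_on R S :&: L) <= 1)%N.
Proof.
move=> S_stable; have [->|[j0 j0S]] := set_0Vmem S.
  by rewrite (leq_trans (dimvS (capvSl _ _))) // dim_supp_on cards0.
pose ev (v : lifting) : R^o := v j0.
have ev_lin : linear ev by move=> k u v; rewrite /ev !ffunE.
pose evL := GRing.isLinear.Build R lifting R^o _ ev ev_lin.
pose Ev : 'Hom(lifting, R^o) := linfun (HB.pack_for {linear lifting -> R^o} ev evL).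
have <- : \dim (Ev @: (supp_on R S :&: L)) = \dim (supp_on R S :&: L).
  rewrite limg_dim_eq //; apply/eqP; rewrite -subv0; apply/subvP => v.
  rewrite memv_cap memv_ker memv0 lfunE /= memv_cap.
  move=> /andP[/andP[/mem_supp_on vS /linealityP[a [b vE]]] /eqP v0].
  rewrite /ev in v0.
  have swapE x y : x \in val j0 -> y \notin val j0 -> a x = a y.
    move=> xj yj; have dj : #|swap (val j0) x y| == d.
      by rewrite card_swap // (eqP (valP j0)).
    have := vS (mk dj) (S_stable j0 (mk dj) x y j0S xj yj erefl).
    move: v0; rewrite !vE /= => v0 v1; have := big_swap a xj yj.
    by move: v0 v1; lra.
  have [x0 x0j] : exists x, x \in val j0.
    by apply/set0Pn; rewrite -card_gt0 (eqP (valP j0)).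
  have [y0 y0j] : exists y, y \notin val j0.
    have /set0Pn[y] : ~: val j0 != finset.set0.
      by rewrite -card_gt0 -(ltn_add2l #|val j0|) cardsC addn0 (eqP (valP j0)) card_ord.
    by rewrite inE => yj; exists y.
  have aE z : a z = a x0.
    have [zj|zj] := boolP (z \in val j0); last by rewrite -(swapE x0 z).
    by rewrite (swapE z y0) // (swapE x0 y0).
  have sumE (i : J) : \sum_(x in val i) a x = a x0 *+ d.
    by rewrite (eq_bigr (fun=> a x0)) => [|x _]; rewrite ?sumr_const ?(eqP (valP i)).
  by apply/eqP/ffunP => j; rewrite ffunE -v0 !vE !sumE.
by apply: leq_trans (dimvS (subvf _)) _; rewrite dimvf.
Qed.

(** The parameter [k.+1] of the moment curve is positive, and so are all entries on [S]. *)
Definition moment_lift (S : {set J}) (k : nat) : lifting :=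
  [ffun j : J => if j \in S then k.+1%:R ^+ index j (enum S) else 0].

(** Points with distinct parameters are independent by the Vandermonde determinant, and there are as
    many as the dimension of [supp_on R S]. *)
Lemma moment_lift_span (S : {set J}) (t : 'I_#|S| -> nat) (W : {vspace lifting}) :
  injective t -> (forall i, moment_lift S (t i) \in W) -> (supp_on R S <= W)%VS.
Proof.
move=> t_inj tW; pose N := #|S|.
pose psi (a : {ffun 'I_N -> R^o}) : lifting := \sum_i a i *: moment_lift S (t i).
have psi_lin : linear psi.
  move=> k a b; rewrite /psi scaler_sumr -big_split; apply: eq_bigr => i _.
  by rewrite !ffunE scalerDl scalerA.
pose psiL := GRing.isLinear.Build R {ffun 'I_N -> R^o} lifting _ psi psi_lin.
pose Psi : 'Hom({ffun 'I_N -> R^o}, lifting) :=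
  linfun (HB.pack_for {linear {ffun 'I_N -> R^o} -> lifting} psi psiL).
have PsiE a : Psi a = psi a by rewrite lfunE.
have PsiS : (Psi @: fullv <= supp_on R S)%VS.
  apply/subvP => v /memv_imgP[a _ ->]; rewrite PsiE; apply: memv_suml => i _.
  by apply/memvZ/mem_supp_on => j jS; rewrite ffunE (negPf jS).
have dimPsi : \dim (Psi @: fullv) = N.
  rewrite limg_dim_eq ?dim_ffun ?card_ord // capfv.
  apply/eqP; rewrite -subv0; apply/subvP => a; rewrite memv_ker memv0 PsiE => /eqP a0.
  pose x := (\row_(i < N) (t i).+1%:R : 'rV[R]_N).
  pose V := Vandermonde N x.
  have Vunit : V \in unitmx.
    rewrite unitmxE unitfE det_Vandermonde; apply/prodf_neq0 => i _.
    apply/prodf_neq0 => j ij; rewrite !mxE subr_eq0 eqr_nat eqSS.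
    by apply: contraTneq ij => /t_inj ->; rewrite ltnn.
  pose b := \col_(i < N) (a i : R).
  have Vb : V *m b = 0.
    apply/colP => s; rewrite !mxE.
    have sS : (s < size (enum S))%N by rewrite -cardE.
    pose j0 := enum_val s.
    have j0S : j0 \in S by exact: enum_valP.
    have ij0 : index j0 (enum S) = s.
      by rewrite /j0 (enum_val_nth j0) index_uniq ?enum_uniq.
    have := congr1 (fun u : lifting => u j0) a0; rewrite sum_ffunE ffunE => sum0.
    rewrite -[RHS]sum0; apply: eq_bigr => i _.
    by rewrite !mxE !ffunE j0S ij0 mulrC.
  have b0 : b = 0 by rewrite -(mulKmx Vunit b) Vb mulmx0.
  apply/eqP/ffunP => i; rewrite ffunE.
  by have := congr1 (fun u : 'cV[R]_N => u i 0) b0; rewrite !mxE.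
have <- : (Psi @: fullv)%VS = supp_on R S.
  by apply/eqP; rewrite eqEdim PsiS dim_supp_on dimPsi leqnn.
apply/subvP => v /memv_imgP[a _ ->]; rewrite PsiE; apply: memv_suml => i _.
by apply: memvZ.
Qed.

Lemma pigeonhole_fiber (K : finType) (f : nat -> K) N :
  exists (t : 'I_N -> nat) k, injective t /\ forall i, f (t i) = k.
Proof.
pose I := 'I_(#|K| * N).+1; pose F k := [set i : I | f i == k].
have [k Nk] : exists k, (N <= #|F k|)%N.
  apply/existsP; apply: contraT => /existsPn lt.
  have : (#|I| <= \sum_(k : K) N)%N.
    rewrite -sum1_card (partition_big (fun i : I => f i) xpredT) //=.
    apply: leq_sum => k _; have := lt k; rewrite -ltnNge => /ltnW; apply: leq_trans.
    by rewrite -[X in (_ <= X)%N]sum1_card; apply/eq_leq/eq_bigl => i; rewrite inE.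
  by rewrite sum_nat_const card_ord ltnn.
exists (fun i => enum_val (widen_ord Nk i) : nat), k; split.
  by move=> i j /val_inj/enum_val_inj/(congr1 val)/= /val_inj.
by move=> i; have := enum_valP (widen_ord Nk i); rewrite inE => /eqP.
Qed.

Lemma Dressian_cone_geq S : stable S ->
  exists2 C : lifting -> Prop, Dressian C & (#|S| <= (cone_dim_mod L C).+1)%N.
Proof.
move=> S_stable.
(* The cells, recorded as families of subsets, make up an element of a finite type, so the
   pigeonhole principle applies to subdivisions. *)
pose cells w : {set {set {set 'I_n}}} := [set M | `[< exists c, M = hyper_cell w c >]].
have [t [K [t_inj tK]]] := pigeonhole_fiber (fun k => cells (moment_lift S k)) #|S|.
have [N0|/card_gt0P[j0 j0S]] := posnP #|S|; last first.
  have i0 : 'I_#|S| by exact: enum_rank_in j0S j0.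
  pose w := moment_lift S (t i0).
  have tp : tropical_plucker w.
    apply: (@stable_tropical_plucker S) => // j.
      by rewrite ffunE; case: ifP => // _; apply: exprn_ge0.
    by move=> jS; rewrite ffunE (negPf jS).
  exists (secondary_cone vert w).
    split; first by exists w.
    by move=> w' w'w P; rewrite w'w; exact: tp.
  have sub : (supp_on R S <= lin_span (secondary_cone vert w))%VS.
    apply: moment_lift_span t_inj _ => i; apply: (proj1 (lin_spanP _)).
    apply/funext => P; apply/propext.
    have cellsE c : `[< exists c', hyper_cell w c = hyper_cell (moment_lift S (t i)) c' >].
      have : hyper_cell w c \in cells (moment_lift S (t i)).
        by rewrite tK -(tK i0) inE; apply/asboolP; exists c.
      by rewrite inE.
    have cellsE' c : `[< exists c', hyper_cell (moment_lift S (t i)) c = hyper_cell w c' >].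
      have : hyper_cell (moment_lift S (t i)) c \in cells w.
        by rewrite /w tK -(tK i) inE; apply/asboolP; exists c.
      by rewrite inE.
    split=> /regular_subdivisionP[c ->]; apply/regular_subdivisionP.
      by have /asboolP[c' ->] := cellsE' c; exists c'.
    by have /asboolP[c' ->] := cellsE c; exists c'.
  (* The dimensions of [supp_on R S] and [L] add up to those of their sum and intersection, and the
     intersection has dimension at most 1. *)
  rewrite /cone_dim_mod -subSn; last by apply/dimvS/addvSr.
  rewrite leq_subRL; last by rewrite ltnW // ltnS; apply/dimvS/addvSr.
  rewrite -{1}(dim_supp_on R S) addnC -dimv_sum_cap -addn1.
  by apply: leq_add; [apply/dimvS/addvS | exact: dim_stable_lineality].
exists (secondary_cone vert 0); last by rewrite N0.
split; first by exists 0.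
move=> w' w'w P; rewrite w'w; apply: (@stable_tropical_plucker S) => // j; by rewrite ffunE.
Qed.

Lemma dim_Dressian_geq : ('C(n, d) <= n * (dim_Dressian R d n).+1)%N.
Proof.
have [S S_stable leS] := stable_ex.
have [C DC leC] := Dressian_cone_geq S_stable.
apply: leq_trans leS _; rewrite leq_mul2l; apply/orP; right.
by apply: leq_trans leC _; rewrite ltnS; exact: leq_fan_dim.
Qed.

Lemma dim_Dressian_lt : (dim_Dressian R d n < 'C(n - 2, d - 1))%N.
Proof.
have bin0 : (0 < 'C(n - 2, d - 1))%N by rewrite bin_gt0; lia.
(* A maximum is bounded through weak inequalities, hence the passage to the predecessor of the
   positive binomial. *)
rewrite -(ltn_predK bin0) ltnS; apply/bigmax_leqP => k /asboolP[C DC <-].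
by rewrite -ltnS (ltn_predK bin0); exact: Dressian_cone_leq.
Qed.

End Bounds.

Theorem theorem31 (R : realType) (n d : nat) (hn : (2 <= n)%N)
    (hd : (1 <= d <= n - 1)%N) :
  1 / n%:R * 'C(n, d)%:R - 1 <= (dim_Dressian R d n)%:R :> R /\
  (dim_Dressian R d n)%:R <= 'C(n - 2, d - 1)%:R - 1 :> R.
Proof.
have [d0 dn] : (0 < d)%N /\ (d < n)%N by lia.
have n0 : 0 < n%:R :> R by rewrite ltr0n; lia.
split.
  rewrite lerBlDr mulrAC mul1r natr1 ler_pdivrMr // mulrC -natrM ler_nat.
  exact: dim_Dressian_geq.
by rewrite lerBrDr natr1 ler_nat; exact: dim_Dressian_lt.
Qed.
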